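(* Let $M\le\min\{P,K\}$, let $b\ge1$ be an integer, let $p_0>0$, let $\mathbf H\in\mathbb C^{P\times K}$ with $\operatorname{rank}(\mathbf H)\ge M$, and let $\mathbf R_{vv}\in\mathbb C^{P\times P}$ be Hermitian positive definite. Let $$\alpha=\frac{\sqrt{4^b}-1}{b\sqrt{4^b}},\qquad\beta=\frac{3b}{4^b-1},\qquad\zeta=\frac{\sqrt{4^b}-2}{b\sqrt{4^b}},$$ and, for a ZF-BDFD transceiver with error covariance matrix $\mathbf R_{ee}$, let $$\tilde P_e=\frac1M\sum_{i=1}^M\Bigl[\alpha\operatorname{erfc}\Bigl(\sqrt{\beta/[\mathbf R_{ee}]_{ii}}\Bigr)+\zeta\operatorname{erfc}\Bigl(3\sqrt{\beta/[\mathbf R_{ee}]_{ii}}\Bigr)\Bigr].$$ The ZF design $(\mathbf F,\mathbf B,\mathbf W)$ specified in the context, which minimizes the arithmetic mean-square error $\operatorname{tr}(\mathbf R_{ee})/M$ over ZF-BDFD transceivers with power bound $p_0$ and results in $\mathbf R_{ee}=\sigma_e^2\mathbf I$ with $\sigma_e^2=\frac M{p_0}\bigl(\prod_{i=1}^M\lambda_i\bigr)^{-1/M}$, also minimizes the bit error rate of the ZF-BDFD at moderate-to-high SNRs, in the sense that it minimizes $\tilde P_e$ over ZF-BDFD transceivers with power bound $p_0$ in the regime $[\mathbf R_{ee}]_{ii}<2\beta/3$, $i=1,\dots,M$.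
   Context: All matrices are complex; $(\cdot)^H$ is the conjugate transpose, $(\cdot)^+$ the Moore–Penrose pseudo-inverse, $\operatorname{erfc}(x)=\frac2{\sqrt\pi}\int_x^\infty e^{-z^2}dz$. Model. The received block is $\mathbf y=\mathbf H\mathbf F\mathbf s+\mathbf v$ with $E[\mathbf s\mathbf s^H]=\mathbf I$, $E[\mathbf s\mathbf v^H]=\mathbf 0$, $E[\mathbf v\mathbf v^H]=\mathbf R_{vv}$. A ZF-BDFD (zero-forcing intra-block decision feedback detector) transceiver with power bound $p_0$ is a triple $(\mathbf F,\mathbf B,\mathbf W)$ with $\mathbf F\in\mathbb C^{K\times M}$, $\mathbf B\in\mathbb C^{M\times M}$ strictly upper triangular, $\mathbf W\in\mathbb C^{M\times P}$, $\operatorname{tr}(\mathbf F\mathbf F^H)\le p_0$ and $\mathbf W\mathbf H\mathbf F=\mathbf B+\mathbf I$. Its error covariance at the decision point, assuming correct past decisions, is $\mathbf R_{ee}=\mathbf W\mathbf R_{vv}\mathbf W^H$. The decision-point SNR of the $i$th symbol is $1/[\mathbf R_{ee}]_{ii}$, and $\tilde P_e$ closely approximates the average bit error rate (assuming correct past decisions) under uniform bit loading with square QAM of $2b$ bits per symbol. The condition $[\mathbf R_{ee}]_{ii}<2\beta/3$, under which $\tilde P_e$ is convex in $[\mathbf R_{ee}]_{ii}$, is what is meant by moderate-to-high SNR. ZF design. Let $\mathbf H^H\mathbf R_{vv}^{-1}\mathbf H=\mathbf V\boldsymbol\Lambda\mathbf V^H$ be the eigenvalue decomposition with eigenvalues $\lambda_1\ge\cdots\ge\lambda_K$;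 let $\tilde{\mathbf V}_M$ be the first $M$ columns of $\mathbf V$ and $\tilde{\boldsymbol\Lambda}_M=\operatorname{diag}(\lambda_1,\dots,\lambda_M)$. Let $\boldsymbol\Psi_{\rm ZF}$ be the unitary matrix obtained by applying Algorithm A below to $\boldsymbol\Gamma=\tilde{\boldsymbol\Lambda}_M^{1/2}$, and let $\tilde{\boldsymbol\Lambda}_M^{1/2}\boldsymbol\Psi_{\rm ZF}=\mathbf Q\bar{\mathbf U}$ be the QR decomposition. Then $\mathbf F=\sqrt{p_0/M}\,\tilde{\mathbf V}_M\boldsymbol\Psi_{\rm ZF}$, $\mathbf B=\bigl(\prod_{i=1}^M\lambda_i\bigr)^{-1/(2M)}\bar{\mathbf U}-\mathbf I$, $\mathbf W=(\mathbf B+\mathbf I)(\mathbf R_{vv}^{-1/2}\mathbf H\mathbf F)^+\mathbf R_{vv}^{-1/2}$. Algorithm A. Input: a diagonal non-singular $M\times M$ matrix $\boldsymbol\Gamma$ with positive diagonal elements $\gamma_1\ge\cdots\ge\gamma_M$. Output: an $M\times M$ unitary matrix $\mathbf S$, with entries $s_{\ell k}$ and $k$th column $[\mathbf S]_{\cdot k}$, intended to make all diagonal elements of the R-factor of the QR decomposition of $\boldsymbol\Gamma\mathbf S$ equal to $(\prod_k\gamma_k)^{1/M}$. Notation: $g=(\prod_{k=1}^M\gamma_k^2)^{1/M}$; $\mathbf Z_k$ is the matrix of the first $k$ columns of $\mathbf S$; $\mathbf Z_k^\perp$ is an $M\times(M-k)$ matrix whose orthonormal columns span the orthogonal complement of the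 columns of $\mathbf Z_k$; $\mathcal P_{\mathbf A}=\mathbf I-\mathbf A(\mathbf A^H\mathbf A)^{-1}\mathbf A^H$; and $\mathbf A^{(k)}=(\boldsymbol\Gamma\mathbf Z_k^\perp)^H\mathcal P_{(\boldsymbol\Gamma\mathbf Z_k)}\boldsymbol\Gamma\mathbf Z_k^\perp$, of size $(M-k)\times(M-k)$. 1. Set $k=1$; $s_{11}=\sqrt{\frac{g-\gamma_M^2}{\gamma_1^2-\gamma_M^2}}$, $s_{M1}=\sqrt{\frac{\gamma_1^2-g}{\gamma_1^2-\gamma_M^2}}$, $s_{\ell1}=0$ for $2\le\ell\le M-1$. 2. Form $\mathbf A^{(k)}$ and its eigendecomposition $\mathbf A^{(k)}=\mathbf V^{(k)}\boldsymbol\Lambda^{(k)}(\mathbf V^{(k)})^H$, eigenvalues $\lambda^{(k)}_1\ge\cdots\ge\lambda^{(k)}_{M-k}$. 3. Set $[\mathbf S]_{\cdot k+1}=\mathbf Z_k^\perp\mathbf V^{(k)}\mathbf y^{(k)}$, where $y^{(k)}_1=\sqrt{\frac{g-\lambda^{(k)}_{M-k}}{\lambda^{(k)}_1-\lambda^{(k)}_{M-k}}}$, $y^{(k)}_{M-k}=\sqrt{\frac{\lambda^{(k)}_1-g}{\lambda^{(k)}_1-\lambda^{(k)}_{M-k}}}$, and $y^{(k)}_\ell=0$ for $2\le\ell\le M-k-1$. 4. Increment $k$. If $k\le M-2$ return to step 2. Otherwise set $[\mathbf S]_{\cdot M}=\mathbf Z_{M-2}^\perp\mathbf V^{(M-2)}\mathbf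 y^{(M-1)}$, where $y^{(M-1)}_1=-\sqrt{\frac{\lambda^{(M-2)}_1-g}{\lambda^{(M-2)}_1-\lambda^{(M-2)}_2}}$, $y^{(M-1)}_2=\sqrt{\frac{g-\lambda^{(M-2)}_2}{\lambda^{(M-2)}_1-\lambda^{(M-2)}_2}}$.
   Formalization: Where Algorithm A is undefined it is completed: if the extreme eigenvalues coincide (0/0), the weights √((g−λ_min)/(λ_max−λ_min)), √((λ_max−g)/(λ_max−λ_min)) are 1, 0; for M=2, step 4 uses Z_0^⊥=V^(0)=I, λ^(0)=γ² and steps 2–3 are skipped; for M=1, S=1. M≥1; QR has positive diagonal. *)

(* Defs.v *)
From HB Require Import structures.
From mathcomp Require Import all_boot all_order all_algebra.
From mathcomp Require Import spectral complex.
From mathcomp Require Import all_classical all_reals all_analysis.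
Set Implicit Arguments.
Unset Strict Implicit.
Unset Printing Implicit Defensive.
Import Order.TTheory GRing.Theory Num.Theory.
Import numFieldNormedType.Exports.
Local Open Scope classical_set_scope.
Local Open Scope ring_scope.
Local Open Scope complex_scope.
Local Open Scope sesquilinear_scope.

Section Matrices.
Variable R : realType.
Local Notation C := R[i].

(* The strict order of R[i] makes [0 < z] mean "z is real and positive". *)
Definition posdefmx n (A : 'M[C]_n) : Prop :=
  A \is hermsymmx /\
  forall x : 'cV[C]_n, x != 0 -> 0 < (x ^t* *m A *m x) 0 0.

(* X = A^(-1/2), for A Hermitian positive definite. *)
Definition inv_sqrtmx n (A X : 'M[C]_n) : Prop :=
  posdefmx X /\ X *m X = invmx A.

(* X is the Moore-Penrose pseudo-inverse of A: the four Penrose equations. *)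
Definition mpinvmx m n (A : 'M[C]_(m, n)) (X : 'M[C]_(n, m)) : Prop :=
  [/\ A *m X *m A = A,
      X *m A *m X = X,
      (A *m X) ^t* = A *m X &
      (X *m A) ^t* = X *m A].

Definition tuple_mx n (l : n.-tuple R) : 'M[C]_n :=
  diag_mx (\row_i (tnth l i)%:C).

Definition evd n (A V : 'M[C]_n) (l : n.-tuple R) : Prop :=
  [/\ V \is unitarymx,
      sorted >=%R l &
      A = V *m tuple_mx l *m V ^t*].

(* The R-factor is normalized to have a positive diagonal, which determines it
   for a nonsingular A. *)
Definition qr n (A Q U : 'M[C]_n) : Prop :=
  [/\ Q \is unitarymx,
      forall i j : 'I_n, (j < i)%N -> U i j = 0,
      forall i : 'I_n, 0 < U i i &
      A = Q *m U].

Definition orth_compl_basis m k n (Z : 'M[C]_(m, k)) (Zp : 'M[C]_(m, n)) : Prop :=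
  Zp ^t* *m Zp = 1%:M /\
  forall x : 'cV[C]_m, Z ^t* *m x = 0 <-> exists c : 'cV[C]_n, x = Zp *m c.

Definition compl_proj m k (A : 'M[C]_(m, k)) : 'M[C]_m :=
  1%:M - A *m invmx (A ^t* *m A) *m A ^t*.

End Matrices.

Section AlgorithmA.
Variable R : realType.
Local Notation C := R[i].

(* wt_fst g a z = sqrt ((g - z) / (a - z)), wt_lst g a z = sqrt ((a - g) / (a - z)),
   where a and z are the largest and the smallest eigenvalue. If a = z, then also
   g = a, and both quotients are 0/0; they are then read as 1 and 0, so that the
   weight vector is still a unit vector. *)
Definition wt_fst (g a z : R) : R :=
  if a == z then 1 else Num.sqrt ((g - z) / (a - z)).

Definition wt_lst (g a z : R) : R :=
  if a == z then 0 else Num.sqrt ((a - g) / (a - z)).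

Definition end_vec n (c d : R) : 'cV[C]_n :=
  \col_i (if i == 0%N :> nat then c
          else if i == n.-1 :> nat then d else 0)%:C.

Variable M : nat.

Definition first_cols (S : 'M[C]_M) (k : 'I_M) : 'M[C]_(M, k) :=
  colsub (widen_ord (ltnW (ltn_ord k))) S.

Definition algA_mx (gam : M.-tuple R) (S : 'M[C]_M) (k : 'I_M)
    (Zp : 'M[C]_(M, M - k)) : 'M[C]_(M - k) :=
  let G := tuple_mx gam in
  (G *m Zp) ^t* *m compl_proj (G *m first_cols S k) *m (G *m Zp).

Definition gam_mean (gam : M.-tuple R) : R :=
  (\prod_(k < M) tnth gam k ^+ 2) `^ (M%:R^-1).

(* S is an output of the algorithm on diag gam for the choices Zp k, V k, l k of
   the orthonormal complement of the first k columns of S and of the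
   eigendecomposition of A^(k). Columns are counted from 0, so that [col k S] is
   the column computed from the first k columns.
   The data for k = 0 (no column fixed, Z_0 empty, A^(0) = diag gam ^ 2) are
   those underlying the first column; they are used again by the formula of the
   last column when M = 2. *)
Record algA_run (gam : M.-tuple R) (S : 'M[C]_M)
    (Zp : forall k : 'I_M, 'M[C]_(M, M - k))
    (V : forall k : 'I_M, 'M[C]_(M - k))
    (l : forall k : 'I_M, (M - k).-tuple R) : Prop := AlgARun {
  algA_col0 : forall k : 'I_M, k = 0%N :> nat ->
    let a := gam`_0 ^+ 2 in
    let z := gam`_(M.-1) ^+ 2 in
    let g := gam_mean gam in
    col k S = end_vec M (wt_fst g a z) (wt_lst g a z);
  algA_data0 : forall k : 'I_M, k = 0%N :> nat ->
    [/\ Zp k = pid_mx M, V k = 1%:M &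
        l k = [tuple gam`_i ^+ 2 | i < M - k]];
  algA_evd : forall k : 'I_M, (0 < k)%N -> (k.+2 <= M)%N ->
    orth_compl_basis (first_cols S k) (Zp k) /\
    evd (algA_mx gam S (Zp k)) (V k) (l k);
  algA_col : forall k : 'I_M, (0 < k)%N -> (k.+2 <= M)%N ->
    let a := (l k)`_0 in
    let z := (l k)`_((M - k).-1) in
    let g := gam_mean gam in
    col k S = Zp k *m V k *m end_vec (M - k) (wt_fst g a z) (wt_lst g a z);
  algA_last : forall k j : 'I_M, k.+2 = M -> j.+1 = M ->
    let a := (l k)`_0 in
    let z := (l k)`_1 in
    let g := gam_mean gam in
    col j S = Zp k *m V k *m end_vec (M - k) (- wt_lst g a z) (wt_fst g a z) }.

Definition algorithmA (gam : M.-tuple R) (S : 'M[C]_M) : Prop :=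
  exists Zp V l, @algA_run gam S Zp V l.

End AlgorithmA.

Section Transceiver.
Variable R : realType.
Local Notation C := R[i].

Definition ZF_BDFD P K M (p0 : R) (H : 'M[C]_(P, K))
    (F : 'M[C]_(K, M)) (B : 'M[C]_M) (W : 'M[C]_(M, P)) : Prop :=
  [/\ forall i j : 'I_M, (j <= i)%N -> B i j = 0,
      \tr (F *m F ^t* ) <= p0%:C &
      W *m H *m F = B + 1%:M].

Definition err_cov P M (Rvv : 'M[C]_P) (W : 'M[C]_(M, P)) : 'M[C]_M :=
  W *m Rvv *m W ^t*.

(* i-th diagonal entry, real since an error covariance is Hermitian *)
Definition mse M (Ree : 'M[C]_M) (i : 'I_M) : R := complex.Re (Ree i i).

Definition amse M (Ree : 'M[C]_M) : R := complex.Re (\tr Ree) / M%:R.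

Definition erfc (x : R) : R :=
  2 / Num.sqrt pi * \int[lebesgue_measure]_(z in `[x, +oo[) expR (- z ^+ 2).

Definition ber_alpha (b : nat) : R :=
  (Num.sqrt (4 ^+ b) - 1) / (b%:R * Num.sqrt (4 ^+ b)).

Definition ber_beta (b : nat) : R := 3 * b%:R / (4 ^+ b - 1).

Definition ber_zeta (b : nat) : R :=
  (Num.sqrt (4 ^+ b) - 2) / (b%:R * Num.sqrt (4 ^+ b)).

Definition ber M (b : nat) (Ree : 'M[C]_M) : R :=
  M%:R^-1 * \sum_(i < M)
    (ber_alpha b * erfc (Num.sqrt (ber_beta b / mse Ree i))
     + ber_zeta b * erfc (3 * Num.sqrt (ber_beta b / mse Ree i))).

Definition mod_high_SNR M (b : nat) (Ree : 'M[C]_M) : Prop :=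
  forall i : 'I_M, mse Ree i < 2 * ber_beta b / 3.

Definition ZF_gram P K (H : 'M[C]_(P, K)) (Rvv : 'M[C]_P) : 'M[C]_K :=
  H ^t* *m invmx Rvv *m H.

(* V and lam are those of the eigendecomposition of [ZF_gram H Rvv]. *)
Definition ZF_design P K M (leMK : (M <= K)%N) (p0 : R) (H : 'M[C]_(P, K))
    (Rvv : 'M[C]_P) (V : 'M[C]_K) (lam : K.-tuple R)
    (F : 'M[C]_(K, M)) (B : 'M[C]_M) (W : 'M[C]_(M, P)) : Prop :=
  let VM : 'M[C]_(K, M) := colsub (widen_ord leMK) V in
  let gam : M.-tuple R := [tuple Num.sqrt lam`_i | i < M] in
  exists (Psi Q U : 'M[C]_M) (Rh : 'M[C]_P) (X : 'M[C]_(M, P)),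
  [/\ algorithmA gam Psi,
      qr (tuple_mx gam *m Psi) Q U,
      F = (Num.sqrt (p0 / M%:R))%:C *: (VM *m Psi) &
      B = ((\prod_(i < M) lam`_i) `^ (- (2 * M)%:R^-1))%:C *: U - 1%:M] /\
  [/\ inv_sqrtmx Rvv Rh,
      mpinvmx (Rh *m H *m F) X &
      W = (B + 1%:M) *m X *m Rh].

End Transceiver.

(* Main.v *)
Require Import Defs.
From HB Require Import structures.
From mathcomp Require Import all_boot all_order all_algebra.
From mathcomp Require Import perm spectral complex.
From mathcomp Require Import all_classical all_reals all_analysis.
From mathcomp Require Import ring lra.
Set Implicit Arguments.
Unset Strict Implicit.
Unset Printing Implicit Defensive.
Import Order.TTheory GRing.Theory Num.Theory.
Import numFieldNormedType.Exports.
Local Open Scope ring_scope.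
Local Open Scope complex_scope.
Local Open Scope sesquilinear_scope.

(** Whiten the channel by [Rvv^(-1/2)]: with [A = Rvv^(-1/2) H F] and
    [Y = W Rvv^(1/2)], zero forcing reads [Y A = B + I], upper unitriangular,
    and [Ree = Y Y^H]. Writing [A = Q U], the matrix [Y Q] is upper triangular
    with diagonal entries [1 / U_ii], so the product of the [Ree_ii] is at least
    [1 / det (A^H A)]. Rotating [V^H F] on the right to lower trapezoidal form,
    Hadamard's inequality and AM-GM bound [det (A^H A)] by
    [lam_1 ... lam_M (p0 / M)^M]; a second AM-GM gives the lower bound
    [sigma_e^2] on the mean of the [Ree_ii].

    Algorithm A keeps the Gram determinant of the first [k] columns of
    [Gamma S] equal to [g^k]. By Schur complements [det A^(k) = g^(M - k)], so
    [g] lies between the extreme eigenvalues of [A^(k)] and the next column is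
    well defined. The R-factor of [Gamma S] then has constant diagonal, which
    makes [B] strictly upper triangular and [Ree = sigma_e^2 I].

    As functions of [x], [erfc (sqrt (beta / x))] and
    [erfc (3 * sqrt (beta / x))] are increasing and lie above their tangents for
    [0 < x < 2 beta / 3]; summing the tangent inequality at [sigma_e^2] over the
    [Ree_ii] compares the bit error rates. *)

(** * Gram matrices and triangular factors *)

Section Adjoint.
Variable C : numClosedFieldType.

Lemma adjmxM m n p (A : 'M[C]_(m, n)) (B : 'M[C]_(n, p)) :
  (A *m B) ^t* = B ^t* *m A ^t*.
Proof. by rewrite trmx_mul map_mxM. Qed.

Lemma adjmx1 n : (1%:M : 'M[C]_n) ^t* = 1%:M.
Proof. by rewrite trmx1 map_mx1. Qed.

Lemma adjmxZ m n (c : C) (A : 'M[C]_(m, n)) : (c *: A) ^t* = c^*%R *: A ^t*.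
Proof. by rewrite linearZ /= map_mxZ. Qed.

Lemma det_adjmx n (A : 'M[C]_n) : \det (A ^t*) = (\det A)^*%R.
Proof. by rewrite det_map_mx det_tr. Qed.

Lemma gram_diag m n (A : 'M[C]_(m, n)) i :
  (A ^t* *m A) i i = \sum_k `|A k i| ^+ 2.
Proof. by rewrite mxE; apply: eq_bigr => k _; rewrite !mxE normCK mulrC. Qed.

Lemma gram_diagr m n (A : 'M[C]_(m, n)) i :
  (A *m A ^t*) i i = \sum_k `|A i k| ^+ 2.
Proof. by rewrite mxE; apply: eq_bigr => k _; rewrite !mxE normCK. Qed.

Lemma gram_eq0 m n (A : 'M[C]_(m, n)) i :
  (A ^t* *m A) i i = 0 -> forall k, A k i = 0.
Proof.
rewrite gram_diag => /eqP; rewrite psumr_eq0 => [/allP h k|k _]; last first.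
  exact: exprn_ge0.
have /implyP/(_ isT) := h k (mem_index_enum k).
by rewrite expf_eq0 /= normr_eq0 => /eqP.
Qed.

(** Gram-Schmidt on the rows of A^H: row i lies in the span of the first i + 1 rows of an
    orthonormal [B], so A^H = D B with [D] lower triangular, and adjoints give the factorization.
    The diagonal is only nonnegative because A may be rank deficient. *)
Lemma qr_exists m n (A : 'M[C]_(m, n)) : (n <= m)%N ->
  exists Q : 'M[C]_(m, n), exists U : 'M[C]_n,
  [/\ Q ^t* *m Q = 1%:M, forall i j : 'I_n, (j < i)%N -> U i j = 0,
      forall i, 0 <= U i i & A = Q *m U].
Proof.
move=> le_nm; have [B /unitarymxP Bu /forallP hB] := schmidt_subproof (A ^t*) le_nm.
pose D := A ^t* *m B ^t*.
have DE i j : D i j = (row i (A ^t*) *m (row j B) ^t*) 0 0.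
  by rewrite !mxE; apply: eq_bigr => k _; rewrite !mxE.
have BE i j : row i B *m (row j B) ^t* = (i == j)%:R%:M.
  apply/matrixP => x y; rewrite !ord1 !mxE eqxx mulr1n.
  have /matrixP/(_ i j) := Bu; rewrite !mxE => <-.
  by apply: eq_bigr => k _; rewrite !mxE.
have Dtrig (i j : 'I_n) : (i < j)%N -> D i j = 0.
  move=> ij; rewrite DE.
  have /andP[/submx_trans h _] := hB i.
  have /h/sub_kermxP -> : (\sum_(k < n | (k <= i)%N) <<row k B>> <=
      kermx ((row j B) ^t*))%MS.
    apply/sumsmx_subP => k ki; rewrite genmxE; apply/sub_kermxP.
    by rewrite BE -val_eqE (ltn_eqF (leq_ltn_trans ki ij)) raddf0.
  by rewrite mxE.
have DB : A ^t* = D *m B.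
  have /submxP[E hE] : (A ^t* <= B)%MS.
    apply/row_subP => i; have /andP[/submx_trans h _] := hB i; apply: h.
    by apply/sumsmx_subP => k _; rewrite genmxE row_sub.
  by rewrite /D hE -(mulmxA E) Bu mulmx1.
exists (B ^t*), (D ^t*); split.
- by rewrite trmxCK.
- by move=> i j ij; rewrite mxE mxE Dtrig ?conjC0.
- move=> i; rewrite mxE mxE conjC_ge0 DE.
  by have /andP[_] := hB i; rewrite dotmxE.
- by rewrite -adjmxM -DB trmxCK.
Qed.

Lemma det_upper n (U : 'M[C]_n) : (forall i j : 'I_n, (j < i)%N -> U i j = 0) ->
  \det U = \prod_i U i i.
Proof.
move=> Uup; rewrite -det_tr det_trig; first by apply: eq_bigr => i _; rewrite mxE.
by apply/is_trig_mxP => i j ij; rewrite mxE Uup.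
Qed.

Lemma det_gram_qr m n (A Q : 'M[C]_(m, n)) (U : 'M[C]_n) :
  Q ^t* *m Q = 1%:M -> (forall i j : 'I_n, (j < i)%N -> U i j = 0) ->
  A = Q *m U -> \det (A ^t* *m A) = \prod_i `|U i i| ^+ 2.
Proof.
move=> Qu Uup ->; rewrite adjmxM -mulmxA (mulmxA _ Q) Qu mul1mx.
rewrite det_mulmx det_adjmx (det_upper Uup) rmorph_prod -big_split /=.
by apply: eq_bigr => i _; rewrite normCK mulrC.
Qed.

(* Hadamard's inequality *)
Lemma det_gram_le m n (A : 'M[C]_(m, n)) : (n <= m)%N ->
  \det (A ^t* *m A) <= \prod_i (A ^t* *m A) i i.
Proof.
move=> le_nm; have [Q [U [Qu Uup U_ge0 AE]]] := qr_exists A le_nm.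
rewrite (det_gram_qr Qu Uup AE); apply: ler_prod => i _.
rewrite exprn_ge0 //= AE adjmxM -mulmxA (mulmxA _ Q) Qu mul1mx gram_diag.
by rewrite (bigD1 i) //= lerDl sumr_ge0 // => k _; rewrite exprn_ge0.
Qed.

(** The bound is the nonnegativity of the squared norm of y - c q^H, the residual of projecting y
    onto q^H. *)
Lemma cauchy_schwarz_unit n (y : 'rV[C]_n) (q : 'cV[C]_n) :
  (q ^t* *m q) 0 0 = 1 -> `|(y *m q) 0 0| ^+ 2 <= (y *m y ^t*) 0 0.
Proof.
move=> q1; set c := (y *m q) 0 0.
have yq : y *m q = c%:M by rewrite [LHS]mx11_scalar.
have qq : q ^t* *m q = 1%:M by rewrite [LHS]mx11_scalar q1.
pose z := y - c *: q ^t*.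
have : 0 <= (z *m z ^t*) 0 0.
  by rewrite gram_diagr sumr_ge0 // => k _; rewrite exprn_ge0.
rewrite /z linearB /= map_mxB -/(z ^t*) adjmxZ trmxCK.
rewrite mulmxBl !mulmxBr -!scalemxAr -!scalemxAl qq yq.
have -> : q ^t* *m y ^t* = (c^*%R)%:M.
  by rewrite -adjmxM yq tr_scalar_mx map_scalar_mx.
rewrite !mxE !mulr1n mulr1 (mulrC c) subrr subr0.
by rewrite subr_ge0 normCK mulrC.
Qed.

(** Strong induction on the column shows that [E] is itself upper triangular, since the pivots of
    [U] are nonzero; the diagonals of a product of upper triangular matrices then multiply. *)
Lemma upper_divr n (E U T : 'M[C]_n) :
  (forall i j : 'I_n, (j < i)%N -> U i j = 0) -> (forall i, U i i != 0) ->
  (forall i j : 'I_n, (j < i)%N -> T i j = 0) -> E *m U = T ->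
  forall i, E i i * U i i = T i i.
Proof.
move=> Uup Un0 Tup EU.
have Eup (i j : 'I_n) : (j < i)%N -> E i j = 0.
  have [k] := ubnP j; elim: k j => // k IH j; rewrite ltnS => jk ji.
  have /matrixP/(_ i j) := EU; rewrite Tup // mxE (bigD1 j) //= big1 => [|l lj].
    by rewrite addr0 => /eqP; rewrite mulf_eq0 (negPf (Un0 _)) orbF => /eqP.
  have := lj; rewrite -val_eqE neq_ltn => /orP[lj'|jl].
    by rewrite IH ?mul0r // ?(leq_trans lj' jk) // (ltn_trans lj').
  by rewrite Uup ?mulr0.
move=> i; rewrite -EU mxE (bigD1 i) //= big1 ?addr0 // => l.
rewrite -val_eqE neq_ltn => /orP[li|il]; first by rewrite Eup ?mul0r.
by rewrite Uup ?mulr0.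
Qed.

(** With A = Q U, the identity (Y Q) U = T forces (Y Q)_ii = 1 / U_ii, and Cauchy-Schwarz bounds |(Y
    Q)_ii|^2 by (Y Y^H)_ii. Multiplying over i leaves the Gram determinant, the product of the
    |U_ii|^2. *)
Lemma det_gram_mul_prod_ge1 p m (Y : 'M[C]_(m, p)) (A : 'M[C]_(p, m))
    (T : 'M[C]_m) : (m <= p)%N ->
  (forall i j : 'I_m, (j < i)%N -> T i j = 0) -> (forall i, T i i = 1) ->
  Y *m A = T ->
  0 < \det (A ^t* *m A) /\
  1 <= \det (A ^t* *m A) * \prod_i (Y *m Y ^t*) i i.
Proof.
move=> le_mp Tup T1 YA.
have [Q [U [Qu Uup U_ge0 AE]]] := qr_exists A le_mp.
have Un0 i : U i i != 0.
  have : \det U != 0.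
    have : \det (Y *m Q *m U) = 1.
      by rewrite -mulmxA -AE YA det_upper // big1.
    by rewrite det_mulmx => /eqP; apply: contraTneq => ->; rewrite mulr0 eq_sym oner_eq0.
  by rewrite det_upper // => /prodf_neq0; apply.
rewrite (det_gram_qr Qu Uup AE); split.
  by apply: prodr_gt0 => i _; rewrite exprn_gt0 // normr_gt0.
rewrite -big_split /= -[leLHS](_ : \prod_(i < m) 1 = 1); last by rewrite big1.
apply: ler_prod => i _; rewrite ler01 /=.
have hE : Y *m Q *m U = T by rewrite -mulmxA -AE.
have := upper_divr Uup Un0 Tup hE i; rewrite T1 => e1.
have e2 : `|(Y *m Q) i i| ^+ 2 <= (Y *m Y ^t*) i i.
  have := @cauchy_schwarz_unit _ (row i Y) (col i Q).
  have -> : ((col i Q) ^t* *m col i Q) 0 0 = 1.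
    have /matrixP/(_ i i) := Qu; rewrite [X in _ = X]mxE eqxx mulr1n => <-; rewrite !mxE.
    by apply: eq_bigr => k _; rewrite !mxE.
  move=> /(_ erefl); congr (_ <= _).
    by congr (`|_| ^+ 2); rewrite !mxE; apply: eq_bigr => k _; rewrite !mxE.
  by rewrite !mxE; apply: eq_bigr => k _; rewrite !mxE.
apply: le_trans (ler_wpM2l _ e2); last by rewrite exprn_ge0.
by rewrite -exprMn -normrM mulrC e1 normr1 expr1n.
Qed.

End Adjoint.

(** * Gram determinants: weighted bound, Schur complement, orthogonal complements *)

Section GramDeterminants.
Variable C : numClosedFieldType.

(** Replacing X by X Q with [Q] unitary changes neither side. The [Q] chosen makes the top m rows
    lower triangular, so column i meets only the weights of index at least i, all at most l_i.
    Hadamard's inequality and then AM-GM conclude. *)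
Lemma det_gram_weighted_le k m (le_mk : (m <= k)%N) (X : 'M[C]_(k, m))
    (l : 'I_k -> C) :
  (forall i, 0 <= l i) -> (forall i j : 'I_k, (i <= j)%N -> l j <= l i) ->
  \det (X ^t* *m diag_mx (\row_i l i) *m X) <=
    \prod_(i < m) l (widen_ord le_mk i) * (\tr (X *m X ^t*) / m%:R) ^+ m.
Proof.
move=> l_ge0 l_anti; pose w := widen_ord le_mk.
(* The QR factorization of the adjoint of the top block T reads T^H = Q U, hence T Q = U^H is lower
   triangular. *)
have [Q [U [Qu Uup _ QU]]] := qr_exists ((rowsub w X) ^t*) (leqnn m).
have Qu' : Q *m Q ^t* = 1%:M by apply: mulmx1C.
pose Z := X *m Q.
have Z0 (i j : 'I_m) : (i < j)%N -> Z (w i) j = 0.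
  move=> ij; have -> : Z (w i) j = (rowsub w X *m Q) i j.
    by rewrite !mxE; apply: eq_bigr => x _; rewrite !mxE.
  have -> : rowsub w X *m Q = U ^t*.
    by rewrite -[rowsub w X]trmxCK QU adjmxM -mulmxA Qu mulmx1.
  by rewrite mxE mxE Uup ?conjC0.
pose D := diag_mx (\row_i l i) : 'M[C]_k.
pose Dh := diag_mx (\row_i sqrtC (l i)) : 'M[C]_k.
have DE : D = Dh ^t* *m Dh.
  apply/matrixP => i j; rewrite /Dh tr_diag_mx map_diag_mx mulmx_diag !mxE.
  have [_|//] := eqVneq i j; rewrite !mulr1n.
  rewrite -[RHS]/((sqrtC (l i))^*%R * sqrtC (l i)) geC0_conj ?sqrtC_ge0 //.
  by rewrite -expr2 sqrtCK.
have detE : \det (X ^t* *m D *m X) = \det ((Dh *m Z) ^t* *m (Dh *m Z)).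
  have -> : (Dh *m Z) ^t* *m (Dh *m Z) = Q ^t* *m (X ^t* *m D *m X) *m Q.
    by rewrite DE !adjmxM !mulmxA.
  by rewrite !det_mulmx mulrC mulrA -det_mulmx Qu' det1 mul1r.
rewrite -/D detE; apply: le_trans (det_gram_le _ le_mk) _.
have ZZ i : (Z ^t* *m Z) i i = \sum_k0 `|Z k0 i| ^+ 2 by rewrite gram_diag.
have trE : \tr (X *m X ^t*) = \sum_i (Z ^t* *m Z) i i.
  rewrite -[RHS]/(\tr _) [RHS]mxtrace_mulC /Z adjmxM mulmxA -(mulmxA X).
  by rewrite Qu' mulmx1.
apply: (@le_trans _ _ (\prod_(i < m) (l (w i) * (Z ^t* *m Z) i i))).
  apply: ler_prod => i _; rewrite gram_diag ZZ sumr_ge0 /= => [|x _]; last first.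
    exact: exprn_ge0.
  rewrite mulr_sumr; apply: ler_sum => x _.
  have -> : (Dh *m Z) x i = sqrtC (l x) * Z x i.
    by rewrite mul_diag_mx mxE [X in X * _]mxE.
  rewrite normrM exprMn ger0_norm ?sqrtC_ge0 // sqrtCK.
  have [xi|ix] := ltnP x i.
    have -> : x = w (Ordinal (ltn_trans xi (ltn_ord i))) by exact: val_inj.
    by rewrite Z0 // normr0 expr0n /= !mulr0.
  by apply: ler_wpM2r; [exact: exprn_ge0 | exact: l_anti].
rewrite big_split /=; apply: ler_wpM2l; first by apply: prodr_ge0 => i _.
rewrite trE.
have := (leif_AGM (A := 'I_m) (E := fun i => (Z ^t* *m Z) i i)) _.
rewrite card_ord => h; apply: h => i _.
by rewrite ZZ sumr_ge0 // => x _; exact: exprn_ge0.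
Qed.

(** Block elimination: the last factor is the determinant of the Schur complement of Z^H Z in the
    Gram matrix of [Z X]. *)
Lemma det_gram_row_mx m k n (Z : 'M[C]_(m, k)) (X : 'M[C]_(m, n)) :
  Z ^t* *m Z \in unitmx ->
  \det ((row_mx Z X) ^t* *m row_mx Z X) =
  \det (Z ^t* *m Z) *
  \det (X ^t* *m (1%:M - Z *m invmx (Z ^t* *m Z) *m Z ^t*) *m X).
Proof.
move=> Nu; set N := Z ^t* *m Z in Nu *.
rewrite tr_row_mx map_col_mx mul_col_row -/N.
set S := X ^t* *m _ *m X.
have -> : block_mx N (Z ^t* *m X) (X ^t* *m Z) (X ^t* *m X) =
    block_mx 1%:M 0 (X ^t* *m Z *m invmx N) 1%:M *m
    block_mx N (Z ^t* *m X) 0 S.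
  rewrite mulmx_block !mul1mx !mul0mx !addr0 (mulmxKV Nu).
  by congr block_mx; rewrite /S mulmxBr mulmx1 mulmxBl !mulmxA addrC subrK.
by rewrite det_mulmx det_lblock !det1 !mul1r det_ublock.
Qed.

(** The dimensions agree only through an equation because [A] may be a [row_mx] with k + (M - k)
    columns. *)
Lemma det_congr_isometry m p (A : 'M[C]_(m, p)) (G : 'M[C]_m) :
  p = m -> A ^t* *m A = 1%:M -> \det (A ^t* *m G *m A) = \det G.
Proof.
move=> pm; case: m / pm A G => A G Au.
by rewrite !det_mulmx mulrC mulrA -det_mulmx (mulmx1C Au) det1 mul1r.
Qed.

(** The left kernel of [Z] consists of the adjoints of the vectors orthogonal to its columns;
    Gram-Schmidt on a basis of it gives the adjoint of [Zp]. Keeping [n] a variable allows the rank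
    of this kernel to be substituted for it. *)
Lemma orth_compl_exists m k n (Z : 'M[C]_(m, k)) : n = (m - k)%N ->
  Z ^t* *m Z = 1%:M ->
  exists Zp : 'M[C]_(m, n), [/\ Zp ^t* *m Zp = 1%:M, Z ^t* *m Zp = 0 &
    forall x : 'cV[C]_m, Z ^t* *m x = 0 -> exists c : 'cV[C]_n, x = Zp *m c].
Proof.
move=> nE Zu; have rkZ : \rank (kermx Z) = n.
  rewrite nE mxrank_ker; congr (_ - _)%N; rewrite -mxrank_tr.
  rewrite -(mxrank_map (@Num.conj C)); apply: mxrank_unitary.
  by apply/unitarymxP; rewrite trmxCK.
case: n / rkZ {nE}.
pose S := schmidt (row_base (kermx Z)).
have SE : (S :=: kermx Z)%MS.
  by apply: eqmx_trans (eqmx_schmidt_free (row_base_free _)) (eq_row_base _).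
have /unitarymxP Su : S \is unitarymx by apply: schmidt_unitarymx; exact: rank_leq_col.
exists (S ^t*); rewrite trmxCK; split => //.
  have /sub_kermxP SZ : (S <= kermx Z)%MS by rewrite SE.
  by rewrite -adjmxM SZ trmx0 map_mx0.
move=> x xZ; have : (x ^t* <= S)%MS.
  rewrite SE; apply/sub_kermxP; rewrite -[Z]trmxCK -adjmxM xZ.
  by rewrite trmx0 map_mx0.
by case/submxP => c hc; exists (c ^t*); rewrite -adjmxM -hc trmxCK.
Qed.

End GramDeterminants.

(** * Sorted eigendecompositions and the weights of Algorithm A *)

Section EigenTuples.
Variable R : realType.
Local Notation C := R[i].

Lemma tuple_mx_adj n (l : n.-tuple R) : (tuple_mx l) ^t* = tuple_mx l.
Proof.
rewrite tr_diag_mx map_diag_mx; congr diag_mx; apply/rowP => i.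
by rewrite !mxE; apply: (@conj_Creal C); rewrite complex_real.
Qed.

Lemma det_tuple_mx n (l : n.-tuple R) :
  \det (tuple_mx l) = (\prod_i tnth l i)%:C.
Proof. by rewrite det_diag rmorph_prod; apply: eq_bigr => i _; rewrite mxE. Qed.

(** The spectral theorem gives the eigenvalues in no particular order; the permutation that sorts
    them is applied to the eigenvectors as well. *)
Lemma evd_exists n (A : 'M[C]_n) : A \is hermsymmx -> exists V l, evd A V l.
Proof.
move=> Ah; have /orthomx_spectralP AE := hermitian_normalmx Ah.
have /mxOverP Dreal := hermitian_spectral_diag_real Ah.
set P := spectralmx A in AE; set D := spectral_diag A in AE Dreal.
have Pu : P \is unitarymx := spectral_unitarymx A.
pose t := [tuple complex.Re (D 0 i) | i < n].
have tE i : (tnth t i)%:C = D 0 i.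
  by rewrite tnth_mktuple RRe_real ?Dreal.
have /tuple_permP[p pE] : perm_eq (sort >=%R t) t by rewrite perm_sort.
pose V := col_perm p (P ^t*).
exists V, [tuple of sort >=%R t]; split.
- apply/unitarymxP; rewrite -[RHS](_ : P ^t* *m P = 1%:M); last first.
    by rewrite -invmx_unitary // mulVmx // unitarymx_unit.
  apply/matrixP => i j; rewrite !mxE [RHS](reindex_perm p) /=.
  by apply: eq_bigr => k _; rewrite !mxE /= conjCK.
- by apply: sort_sorted => x y; exact: le_total.
rewrite {1}AE invmx_unitary //; apply/matrixP => i j.
rewrite !mul_mx_diag !mxE [LHS](reindex_perm p) /=.
apply: eq_bigr => k _; rewrite !mxE /= conjCK -tE; congr (_ * _%:C * _).
by rewrite (tnth_nth 0 [tuple of sort _ _]) /= pE -tnth_nth !tnth_mktuple.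
Qed.

Lemma evd_diag n (A V : 'M[C]_n) (l : n.-tuple R) :
  evd A V l -> V ^t* *m A *m V = tuple_mx l.
Proof.
case=> Vu _ ->; have Vu' : V ^t* *m V = 1%:M.
  by rewrite -invmx_unitary // mulVmx // unitarymx_unit.
by rewrite !mulmxA Vu' mul1mx -mulmxA Vu' mulmx1.
Qed.

Lemma evd_det n (A V : 'M[C]_n) (l : n.-tuple R) :
  evd A V l -> \det A = (\prod_i tnth l i)%:C.
Proof.
case=> /unitarymxP Vu _ ->.
by rewrite !det_mulmx mulrC mulrA -det_mulmx (mulmx1C Vu) det1 mul1r det_tuple_mx.
Qed.

(** The i-th eigenvalue is the squared norm of column i of G V. *)
Lemma evd_gram_ge0 m n (G : 'M[C]_(m, n)) V (l : n.-tuple R) :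
  evd (G ^t* *m G) V l -> forall i, 0 <= tnth l i.
Proof.
move=> /evd_diag E i; rewrite -lecR.
have -> : (tnth l i)%:C = ((G *m V) ^t* *m (G *m V)) i i.
  by rewrite adjmxM !mulmxA -(mulmxA (V ^t*)) E !mxE eqxx.
by rewrite gram_diag sumr_ge0 // => k _; rewrite exprn_ge0.
Qed.

Lemma sorted_ge_nth n (l : n.-tuple R) (i j : nat) :
  sorted >=%R l -> (i <= j < n)%N -> l`_j <= l`_i.
Proof.
move=> ls /andP[ij jn].
apply: (sorted_leq_nth (leT := >=%R)) => //; rewrite ?inE ?size_tuple //.
- by move=> x y z h1 h2; exact: le_trans h2 h1.
- by move=> x; exact: lexx.
- exact: leq_ltn_trans jn.
Qed.

(** The product g^n lies between the n-th powers of the smallest and of the largest entry. *)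
Lemma sorted_gmean_bounds n (l : n.-tuple R) (g : R) : (0 < n)%N ->
  sorted >=%R l -> (forall i, 0 <= tnth l i) -> 0 < g ->
  \prod_i tnth l i = g ^+ n -> l`_n.-1 <= g <= l`_0.
Proof.
move=> n_gt0 ls l_ge0 g_gt0 lg.
have l0 i : (i < n)%N -> 0 <= l`_i.
  by move=> lin; rewrite -(tnth_nth 0 l (Ordinal lin)).
have powE (x : R) : x ^+ n = \prod_(i < n) x by rewrite prodr_const card_ord.
apply/andP; split.
  rewrite -(@ler_pXn2r _ n) ?nnegrE ?(ltW g_gt0) ?l0 ?ltn_predL // -lg.
  rewrite powE; apply: ler_prod => i _.
  rewrite l0 ?ltn_predL // (tnth_nth 0) sorted_ge_nth // -ltnS prednK //.
  by rewrite ltn_ord leqnn.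
rewrite -(@ler_pXn2r _ n) ?nnegrE ?(ltW g_gt0) ?l0 // -lg.
rewrite powE; apply: ler_prod => i _.
by rewrite l_ge0 (tnth_nth 0) sorted_ge_nth /= ?ltn_ord.
Qed.

(** Together with [wt_mean]: the squared weights are the convex weights that average the extreme
    eigenvalues a and z to g, also under the convention for a = z. *)
Lemma wt_norm (g a z : R) : z <= g <= a ->
  wt_fst g a z ^+ 2 + wt_lst g a z ^+ 2 = 1.
Proof.
rewrite /wt_fst /wt_lst; case: eqVneq => [_ _|az /andP[zg ga]].
  by rewrite expr1n expr0n addr0.
have az0 : 0 < a - z by rewrite subr_gt0 lt_neqAle eq_sym az (le_trans zg).
rewrite !sqr_sqrtr ?divr_ge0 ?subr_ge0 ?(le_trans zg) // -mulrDl addrC addrA.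
by rewrite subrK divff // gt_eqF.
Qed.

Lemma wt_mean (g a z : R) : z <= g <= a ->
  a * wt_fst g a z ^+ 2 + z * wt_lst g a z ^+ 2 = g.
Proof.
rewrite /wt_fst /wt_lst; case: eqVneq => [->|az /andP[zg ga]].
  by rewrite expr1n expr0n mulr0 mulr1 addr0 => /le_anti.
have az0 : 0 < a - z by rewrite subr_gt0 lt_neqAle eq_sym az (le_trans zg).
rewrite !sqr_sqrtr ?divr_ge0 ?subr_ge0 ?(le_trans zg) //.
by field; rewrite gt_eqF.
Qed.

Lemma end_vec_adj n (c d : R) : (end_vec n c d) ^t* = (end_vec n c d)^T.
Proof.
apply/matrixP => i j; rewrite !mxE.
by apply: (@conj_Creal C); rewrite complex_real.
Qed.

(** For 1 < n the first and the last index differ, so exactly two terms of the sum survive. *)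
Lemma end_vec_form n (l : n.-tuple R) (c d c' d' : R) : (1 < n)%N ->
  (end_vec n c d) ^t* *m tuple_mx l *m end_vec n c' d' =
  (l`_0 * (c * c') + l`_n.-1 * (d * d'))%:C%:M.
Proof.
case: n l => [|[|n]] // l _; rewrite end_vec_adj.
rewrite [LHS]mx11_scalar; congr _%:M.
rewrite mul_mx_diag !mxE (bigD1 ord0) //= (bigD1 ord_max) //= big1 => [|i /andP[i0 im]].
  rewrite !mxE /= !(tnth_nth 0) /= addr0 -!rmorphM -rmorphD /=.
  by rewrite eqxx (mulrC c) (mulrC d) !mulrA.
rewrite !mxE; have -> : (i == 0%N :> nat) = false by rewrite -[RHS](negPf i0).
have -> : (i == n.+1 :> nat) = false by rewrite -[RHS](negPf im).
by rewrite mulr0.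
Qed.

Lemma end_vec_dot n (c d c' d' : R) : (1 < n)%N ->
  (end_vec n c d) ^t* *m end_vec n c' d' = (c * c' + d * d')%:C%:M.
Proof.
move=> n1; have := end_vec_form [tuple 1 | i < n] c d c' d' n1.
have -> : tuple_mx [tuple (1 : R) | i < n] = 1%:M.
  by apply/matrixP => i j; rewrite !mxE tnth_mktuple.
rewrite mulmx1 => ->; have n0 := ltnW n1.
have E i : (i < n)%N -> [tuple (1 : R) | i < n]`_i = 1.
  move=> lin; rewrite -(tnth_nth 0 [tuple (1 : R) | i < n] (Ordinal lin)).
  by rewrite tnth_mktuple.
by rewrite !E ?ltn_predL // !mul1r.
Qed.

End EigenTuples.

(** * Algorithm A *)

Section AlgorithmA_correct.
Variable R : realType.
Local Notation C := R[i].

(** The orthogonal projection is Hermitian and idempotent; this form of the fact exhibits A^(k) as a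
    Gram matrix. *)
Lemma compl_proj_idem m k (A : 'M[C]_(m, k)) : A ^t* *m A \in unitmx ->
  (compl_proj A) ^t* *m compl_proj A = compl_proj A.
Proof.
move=> Nu; set N := A ^t* *m A in Nu *.
have NE : N ^t* = N by rewrite /N adjmxM trmxCK.
have PE : (compl_proj A) ^t* = compl_proj A.
  rewrite /compl_proj -/N linearB /= map_mxB -!/(_ ^t*) adjmx1 !adjmxM trmxCK.
  by rewrite trmx_inv map_invmx -/(N ^t*) NE mulmxA.
rewrite PE /compl_proj -/N mulmxBl mul1mx mulmxBr mulmx1.
rewrite -!mulmxA (mulmxA (A ^t*) A) -/N (mulmxA N) mulmxV // mul1mx.
by rewrite subrr subr0.
Qed.

Variable M : nat.
Variable gam : M.-tuple R.
Hypothesis M_gt0 : (0 < M)%N.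
Hypothesis gam_gt0 : forall i, 0 < tnth gam i.
Let G := tuple_mx gam.
Let g := gam_mean gam.

Lemma gam_mean_gt0 : 0 < g.
Proof. by apply: powR_gt0; apply: prodr_gt0 => i _; rewrite exprn_gt0. Qed.

Lemma gam_mean_expn : g ^+ M = \prod_i tnth gam i ^+ 2.
Proof.
have P0 : 0 <= \prod_i tnth gam i ^+ 2 by apply: prodr_ge0 => i _; exact: sqr_ge0.
rewrite -powR_mulrn ?powR_ge0 // -powRrM mulVf ?powRr1 //.
by rewrite pnatr_eq0 -lt0n.
Qed.

Lemma det_gram_gam : \det (G ^t* *m G) = (g ^+ M)%:C.
Proof.
rewrite tuple_mx_adj det_mulmx det_tuple_mx -rmorphM gam_mean_expn.
by rewrite -big_split.
Qed.

(** The loop invariant of the algorithm. The bound on k is quantified inside, so that k ranges over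
    natural numbers and may equal M. *)
Definition algA_inv (S : 'M[C]_M) (k : nat) : Prop :=
  forall le_kM : (k <= M)%N, let Z := colsub (widen_ord le_kM) S in
  Z ^t* *m Z = 1%:M /\ \det ((G *m Z) ^t* *m (G *m Z)) = (g ^+ k)%:C.

Lemma algA_inv0 S : algA_inv S 0.
Proof. by move=> le_kM Z; split; [apply/matrixP => -[] | rewrite det_mx00]. Qed.

Lemma algA_inv_unit S (k : 'I_M) : algA_inv S k ->
  (G *m first_cols S k) ^t* *m (G *m first_cols S k) \in unitmx.
Proof.
move=> /(_ (ltnW (ltn_ord k)))[_ dE]; rewrite unitmxE unitfE /first_cols dE.
by rewrite fmorph_eq0 expf_eq0 (gt_eqF gam_mean_gt0) andbF.
Qed.

Lemma colsub_widenS (S : 'M[C]_M) (k : 'I_M) (le : (k + 1 <= M)%N) :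
  colsub (widen_ord le) S = row_mx (first_cols S k) (col k S).
Proof.
apply/matrixP => i j; rewrite !mxE; case: splitP => x xE; rewrite !mxE.
  by congr (S _ _); apply: val_inj.
by congr (S _ _); apply: val_inj; rewrite /= xE ord1 addn0.
Qed.

Lemma algA_isom_step (S : 'M[C]_M) (k : 'I_M) :
  (first_cols S k) ^t* *m first_cols S k = 1%:M ->
  (first_cols S k) ^t* *m col k S = 0 ->
  (col k S) ^t* *m col k S = 1%:M ->
  forall le : (k.+1 <= M)%N,
  (colsub (widen_ord le) S) ^t* *m colsub (widen_ord le) S = 1%:M.
Proof.
move=> Zu Zs su; rewrite -(addn1 k) => le.
rewrite colsub_widenS tr_row_mx map_col_mx mul_col_row Zu Zs su.
have -> : (col k S) ^t* *m first_cols S k = 0.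
  by rewrite -[first_cols S k]trmxCK -adjmxM Zs trmx0 map_mx0.
by rewrite -scalar_mx_block.
Qed.

(** The Schur complement of the new column is the scalar g, so appending the column multiplies the
    Gram determinant by g. *)
Lemma algA_inv_step S (k : 'I_M) : algA_inv S k ->
  (first_cols S k) ^t* *m col k S = 0 ->
  (col k S) ^t* *m col k S = 1%:M ->
  (G *m col k S) ^t* *m compl_proj (G *m first_cols S k) *m (G *m col k S) =
    g%:C%:M ->
  algA_inv S k.+1.
Proof.
move=> Sk Zs su sGs; have Nu := algA_inv_unit Sk.
have [Zu dE] := Sk (ltnW (ltn_ord k)).
move=> le Z; split; first exact: algA_isom_step.
rewrite {}/Z; move: le; rewrite -(addn1 k) => le.
rewrite colsub_widenS mul_mx_row det_gram_row_mx // -/(compl_proj _) sGs.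
by rewrite [X in X * _]dE det_scalar1 exprD rmorphM.
Qed.

Definition algA_choice (S : 'M[C]_M) (k : 'I_M)
    (Zp : 'M[C]_(M, M - k)) (V : 'M[C]_(M - k))
    (l : (M - k).-tuple R) : Prop :=
  orth_compl_basis (first_cols S k) Zp /\ evd (algA_mx gam S Zp) V l.

Lemma orth_compl_dot m k n (Z : 'M[C]_(m, k)) (Zp : 'M[C]_(m, n)) :
  orth_compl_basis Z Zp -> Z ^t* *m Zp = 0.
Proof.
case=> _ h; apply/matrixP => i j.
have /h E : exists c : 'cV[C]_n, col j Zp = Zp *m c.
  by exists (delta_mx j 0); exact: colE.
rewrite [RHS]mxE; have /matrixP/(_ i 0) := E; rewrite [X in _ = X]mxE => <-; rewrite !mxE.
by apply: eq_bigr => x _; rewrite !mxE.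
Qed.

Lemma algA_mx_gram (S : 'M[C]_M) (k : 'I_M) (Zp : 'M[C]_(M, M - k)) : algA_inv S k ->
  algA_mx gam S Zp =
  (compl_proj (G *m first_cols S k) *m (G *m Zp)) ^t* *m
  (compl_proj (G *m first_cols S k) *m (G *m Zp)).
Proof.
move=> Sk; rewrite [in RHS]adjmxM -mulmxA (mulmxA (_ ^t*) _ (G *m Zp)).
by rewrite compl_proj_idem ?algA_inv_unit // /algA_mx mulmxA.
Qed.

(** Since [Z Zp] is unitary, the Gram determinant of G [Z Zp] is g^M; the Schur complement formula
    writes it as g^k det A^(k). Hence the eigenvalues of A^(k) have geometric mean g, and the
    radicands of the next weights are nonnegative. *)
Lemma algA_bounds S (k : 'I_M) Zp V l : algA_inv S k -> @algA_choice S k Zp V l ->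
  l`_(M - k).-1 <= g <= l`_0.
Proof.
move=> Sk [Zo Ae]; have [_ ls _] := Ae.
have [Zu dE] := Sk (ltnW (ltn_ord k)).
have ZZp := orth_compl_dot Zo; have [Zpu _] := Zo.
have kM : (k + (M - k) = M)%N by rewrite subnKC // ltnW.
apply: sorted_gmean_bounds => //.
- by rewrite subn_gt0.
- by move: (Ae); rewrite algA_mx_gram // => /evd_gram_ge0.
- exact: gam_mean_gt0.
apply: complexI; rewrite -(evd_det Ae).
have gk0 : ((g ^+ k)%:C : C) != 0.
  by rewrite fmorph_eq0 expf_eq0 (gt_eqF gam_mean_gt0) andbF.
apply: (mulfI gk0); transitivity (\det (G ^t* *m G)); last first.
  by rewrite det_gram_gam -rmorphM -exprD kM.
rewrite -[X in X * _]dE /algA_mx -/G -(det_gram_row_mx (G *m Zp)) ?algA_inv_unit //.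
rewrite -mul_mx_row adjmxM -mulmxA (mulmxA _ G) mulmxA det_congr_isometry //.
rewrite tr_row_mx map_col_mx mul_col_row Zu ZZp Zpu.
have -> : Zp ^t* *m colsub (widen_ord (ltnW (ltn_ord k))) S = 0.
  by rewrite -[X in _ *m X]trmxCK -adjmxM ZZp trmx0 map_mx0.
by rewrite -scalar_mx_block.
Qed.

Lemma algA_choice_dot S (k : 'I_M) Zp V l (y y' : 'cV[C]_(M - k)) :
  @algA_choice S k Zp V l -> (Zp *m V *m y) ^t* *m (Zp *m V *m y') = y ^t* *m y'.
Proof.
case=> -[Zpu _] [/unitarymxP/mulmx1C Vu _ _].
by rewrite !adjmxM !mulmxA -(mulmxA _ _ Zp) Zpu mulmx1 -(mulmxA _ _ V) Vu mulmx1.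
Qed.

Lemma algA_choice_orth S (k : 'I_M) Zp V l (y : 'cV[C]_(M - k)) :
  @algA_choice S k Zp V l -> (first_cols S k) ^t* *m (Zp *m V *m y) = 0.
Proof. by case=> /orth_compl_dot ZZp _; rewrite !mulmxA ZZp !mul0mx. Qed.

Lemma algA_choice_quad S (k : 'I_M) Zp V l (y : 'cV[C]_(M - k)) :
  @algA_choice S k Zp V l ->
  (G *m (Zp *m V *m y)) ^t* *m compl_proj (G *m first_cols S k) *m
    (G *m (Zp *m V *m y)) = y ^t* *m tuple_mx l *m y.
Proof.
case=> _ Ae; rewrite -(evd_diag Ae) /algA_mx -/G !adjmxM !mulmxA.
by rewrite -!mulmxA.
Qed.

(** In the eigenbasis of A^(k) the weight vector has norm 1 by [wt_norm], and its quadratic form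
    equals g by [wt_mean]. *)
Lemma algA_step S (k : 'I_M) Zp V l : (k.+2 <= M)%N ->
  algA_inv S k -> @algA_choice S k Zp V l ->
  col k S = Zp *m V *m
    end_vec (M - k) (wt_fst g l`_0 l`_(M - k).-1) (wt_lst g l`_0 l`_(M - k).-1) ->
  algA_inv S k.+1.
Proof.
move=> kM Sk ch sE; have bd := algA_bounds Sk ch.
have n1 : (1 < M - k)%N by rewrite ltn_subRL addn1.
apply: algA_inv_step => //.
- by rewrite sE (algA_choice_orth _ ch).
- by rewrite sE (algA_choice_dot _ _ ch) end_vec_dot // -!expr2 wt_norm.
- by rewrite sE (algA_choice_quad _ ch) end_vec_form // -!expr2 wt_mean.
Qed.

(** The last two columns combine the same two eigenvectors with coefficients (c, d) and (-d, c), so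
    they are orthonormal, and both are orthogonal to the first M - 2 columns. *)
Lemma algA_last_unitary S (k : 'I_M) (j : 'I_M) Zp V l : k.+2 = M -> j.+1 = M ->
  algA_inv S k -> @algA_choice S k Zp V l ->
  col k S = Zp *m V *m
    end_vec (M - k) (wt_fst g l`_0 l`_(M - k).-1) (wt_lst g l`_0 l`_(M - k).-1) ->
  col j S = Zp *m V *m
    end_vec (M - k) (- wt_lst g l`_0 l`_1) (wt_fst g l`_0 l`_1) ->
  S ^t* *m S = 1%:M.
Proof.
move=> kM jM Sk ch sk sj; have bd := algA_bounds Sk ch.
have Mk : (M - k = 2)%N by apply/eqP; rewrite -(eqn_add2l k) subnKC ?addn2 ?kM // ltnW.
have n1 : (1 < M - k)%N by rewrite Mk.
have kM' : (k.+2 <= M)%N by rewrite kM.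
have Mk1 : ((M - k).-1 = 1)%N by rewrite Mk.
have Sj : algA_inv S j.
  have -> : (j = k.+1 :> nat) by apply: succn_inj; rewrite jM kM.
  exact: algA_step sk.
(* The formula for column k uses the last eigenvalue, that for column j the second one; they
   coincide because M - k = 2. *)
rewrite Mk1 in sk bd.
have [Zu _] := Sj (ltnW (ltn_ord j)).
suff h : forall le : (j.+1 <= M)%N,
    (colsub (widen_ord le) S) ^t* *m colsub (widen_ord le) S = 1%:M.
  move: h; rewrite jM => /(_ (leqnn M)); rewrite (_ : colsub _ S = S) //.
  by apply/matrixP => x y; rewrite mxE; congr (S _ _); exact: val_inj.
apply: algA_isom_step => //.
- apply/matrixP => x y; rewrite ord1 [RHS]mxE.
  have -> : ((first_cols S j) ^t* *m col j S) x 0 =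
      ((col (widen_ord (ltnW (ltn_ord j)) x) S) ^t* *m col j S) 0 0.
    by rewrite !mxE; apply: eq_bigr => i _; rewrite !mxE.
  have xk : (x <= k)%N.
    by rewrite -ltnS -(succn_inj (etrans jM (esym kM))) ltn_ord.
  have [xk'|xk'] := ltnP x k.
    have := congr1 (fun X : 'cV[C]_k => X (Ordinal xk') 0)
      (algA_choice_orth (end_vec (M - k) (- wt_lst g l`_0 l`_1) (wt_fst g l`_0 l`_1)) ch).
    rewrite -sj [X in _ = X]mxE => <-; rewrite !mxE.
    by apply: eq_bigr => i _; rewrite !mxE; congr (Num.conj (S _ _) * _); exact: val_inj.
  have -> : widen_ord (ltnW (ltn_ord j)) x = k.
    by apply: val_inj; apply/eqP; rewrite eqn_leq xk xk'.
  rewrite sk sj (algA_choice_dot _ _ ch) end_vec_dot //.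
  by rewrite mulrN (mulrC (wt_lst _ _ _)) addNr raddf0 mxE.
- by rewrite sj (algA_choice_dot _ _ ch) end_vec_dot // mulrNN -!expr2 addrC wt_norm.
Qed.

End AlgorithmA_correct.

(** * Existence and unitarity of the runs of Algorithm A *)

Section AlgorithmA_runs.
Variable R : realType.
Local Notation C := R[i].

Lemma sorted_mktuple n (f : nat -> R) :
  (forall i j, (i <= j < n)%N -> f j <= f i) -> sorted >=%R [tuple f i | i < n].
Proof.
move=> h; apply/(sortedP 0) => i; rewrite size_tuple => ilt.
rewrite -(tnth_nth 0 [tuple f i | i < n] (Ordinal (ltnW ilt))).
rewrite -(tnth_nth 0 [tuple f i | i < n] (Ordinal ilt)) !tnth_mktuple.
by apply: h; rewrite leqnSn.
Qed.

Lemma nth_mktuple_nat n (f : nat -> R) i : (i < n)%N -> [tuple f i | i < n]`_i = f i.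
Proof.
by move=> ilt; rewrite -(tnth_nth 0 [tuple f i | i < n] (Ordinal ilt)) tnth_mktuple.
Qed.

Definition algA_gam2 M (gam : M.-tuple R) n : n.-tuple R :=
  [tuple gam`_i ^+ 2 | i < n].

(* The data prescribed for k = 0 obey the specification of the later steps, with
   Z_0 empty and A^(0) = Gamma^2, so that step 0 needs no separate treatment. *)
Lemma algA_choice0 M (gam : M.-tuple R) (S : 'M[C]_M) (k : 'I_M) :
  (forall i, 0 < tnth gam i) -> sorted >=%R gam -> k = 0%N :> nat ->
  algA_choice gam S (pid_mx M : 'M[C]_(M, M - k)) 1%:M (algA_gam2 gam _).
Proof.
case: M gam S k => [|m] gam S k gam_gt0 gs k0; first by case: k k0.
have -> : k = ord0 by apply: val_inj.
rewrite /algA_choice /algA_mx -[(m.+1 - ord0)%N]/m.+1 pid_mx_1; split.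
  split; first by rewrite adjmx1 mulmx1.
  move=> x; split => [_|_]; first by exists x; rewrite mul1mx.
  by apply/matrixP => -[].
split.
- by apply/unitarymxP; rewrite adjmx1 mulmx1.
- apply: (@sorted_mktuple _ (fun i => gam`_i ^+ 2)) => i j /andP[ij jm].
  rewrite ler_pXn2r ?nnegrE //; first by apply: sorted_ge_nth; rewrite ?ij.
    by rewrite ltW // -(tnth_nth 0 gam (Ordinal jm)).
  by rewrite ltW // -(tnth_nth 0 gam (Ordinal (leq_ltn_trans ij jm))).
rewrite adjmx1 !mulmx1 mul1mx /compl_proj.
rewrite [tuple_mx gam *m first_cols S ord0]thinmx0 !mul0mx subr0 mulmx1.
rewrite tuple_mx_adj; apply/matrixP => i j; rewrite mulmx_diag !mxE.
have [_|//] := eqVneq; rewrite !mulr1n tnth_mktuple (tnth_nth 0).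
by rewrite -rmorphM.
Qed.

Lemma algA_col0E M (gam : M.-tuple R) (k : 'I_M) (g : R) : k = 0%N :> nat ->
  let l := algA_gam2 gam (M - k) in
  (pid_mx M : 'M[C]_(M, M - k)) *m 1%:M *m
    end_vec (M - k) (wt_fst g l`_0 l`_(M - k).-1) (wt_lst g l`_0 l`_(M - k).-1)
  = end_vec M (wt_fst g (gam`_0 ^+ 2) (gam`_M.-1 ^+ 2))
              (wt_lst g (gam`_0 ^+ 2) (gam`_M.-1 ^+ 2)).
Proof.
case: M gam k => [|m] gam k k0; first by case: k k0.
have -> : k = ord0 by apply: val_inj.
rewrite -[(m.+1 - ord0)%N]/m.+1 pid_mx_1 => l; rewrite mulmx1 mul1mx.
by rewrite /l /algA_gam2 !(nth_mktuple_nat (fun i => gam`_i ^+ 2)).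
Qed.

(** A single step of a run, with the first step in the same format as the later ones, so that runs
    can be built column by column. *)
Definition algA_good M (gam : M.-tuple R) (S : 'M[C]_M) (k : 'I_M)
    (Zp : 'M[C]_(M, M - k)) (V : 'M[C]_(M - k)) (l : (M - k).-tuple R) : Prop :=
  [/\ k = 0%N :> nat -> [/\ Zp = pid_mx M, V = 1%:M & l = algA_gam2 gam _],
      algA_choice gam S Zp V l &
      col k S = Zp *m V *m
        end_vec (M - k) (wt_fst (gam_mean gam) l`_0 l`_(M - k).-1)
                        (wt_lst (gam_mean gam) l`_0 l`_(M - k).-1)].

Variable M : nat.
Variable gam : M.-tuple R.
Hypothesis M_gt0 : (0 < M)%N.
Hypothesis gam_gt0 : forall i, 0 < tnth gam i.
Hypothesis gam_sorted : sorted >=%R gam.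

Lemma algA_run_good (S : 'M[C]_M) Zp V l : algA_run gam S Zp V l ->
  forall k : 'I_M, (k.+2 <= M)%N -> algA_good gam S (Zp k) (V k) (l k).
Proof.
case=> c0 d0 e1 c1 _ k kM; have [k0|k_gt0] := posnP k; last first.
  split; first by move=> k0; rewrite k0 in k_gt0.
    exact: e1.
  exact: c1.
have [-> -> ->] := d0 k k0; split => //; first exact: algA_choice0.
by rewrite algA_col0E // c0.
Qed.

Lemma algA_run_inv (S : 'M[C]_M) Zp V l : algA_run gam S Zp V l ->
  forall k, (k < M)%N -> algA_inv gam S k.
Proof.
move=> run; elim => [|k IH] kM; first exact: algA_inv0.
have [_ ch cE] := @algA_run_good _ _ _ _ run (Ordinal (ltnW kM)) kM.
apply: (@algA_step R M gam M_gt0 gam_gt0 S (Ordinal (ltnW kM)) _ _ _ kM _ ch cE).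
exact: IH (ltnW kM).
Qed.

Lemma algA_run_unitary (S : 'M[C]_M) Zp V l : algA_run gam S Zp V l ->
  S ^t* *m S = 1%:M.
Proof.
move=> run; have [M1|M1] := leqP M 1; last first.
  have kM : (M.-2 < M)%N by case: (M) M1 => [|[|m]] //= _; rewrite ltnW.
  have jM : (M.-1 < M)%N by rewrite ltn_predL.
  have kE : (M.-2.+2 = M)%N by case: (M) M1 => [|[|m]].
  have jE : (M.-1.+1 = M)%N by rewrite prednK.
  have kE' : ((Ordinal kM).+2 <= M)%N by rewrite /= kE.
  have [_ ch cE] := @algA_run_good _ _ _ _ run (Ordinal kM) kE'.
  have := algA_last run; move=> /(_ (Ordinal kM) (Ordinal jM) kE jE) lE.
  apply: (@algA_last_unitary R M gam M_gt0 gam_gt0 S (Ordinal kM) (Ordinal jM)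
    _ _ _ kE jE _ ch cE lE).
  exact: (algA_run_inv run).
(* For M = 1 the only column comes from the initial step; there a = z, and the convention for 0/0
   makes its entry 1. *)
have {M1} ME : M = 1%N by apply/eqP; rewrite eqn_leq M1.
have k0 : (0 < M)%N by rewrite ME.
have := algA_col0 run; move=> /(_ (Ordinal k0) erefl) /=.
have -> : wt_fst (gam_mean gam) (gam`_0 ^+ 2) (gam`_M.-1 ^+ 2) = 1.
  by rewrite /wt_fst (_ : M.-1 = 0%N) ?eqxx // ME.
move=> cE; apply/matrixP => i j.
have ij (x : 'I_M) : x = Ordinal k0.
  by apply: val_inj => /=; case: x => -[|x] //=; rewrite ME.
rewrite (ij i) (ij j) mxE (bigD1 (Ordinal k0)) //= big1 => [|x]; last first.
  by rewrite (ij x) eqxx.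
have SE : S (Ordinal k0) (Ordinal k0) = 1.
  have := congr1 (fun X : 'cV[C]_M => X (Ordinal k0) 0) cE.
  by rewrite !mxE /=.
by rewrite !mxE SE conjC1 mulr1 addr0 eqxx.
Qed.

(** Step k reads only the columns before k, so overwriting column n preserves all steps before n and
    the data chosen for step n. *)
Definition set_col (S : 'M[C]_M) (n : 'I_M) (v : 'cV[C]_M) : 'M[C]_M :=
  \matrix_(i, j) if j == n then v i 0 else S i j.

Lemma col_set_col S n v : col n (set_col S n v) = v.
Proof. by apply/matrixP => i j; rewrite !mxE eqxx ord1. Qed.

Lemma col_set_col_lt S (n k : 'I_M) v : (k < n)%N ->
  col k (set_col S n v) = col k S.
Proof.
by move=> kn; apply/matrixP => i j; rewrite !mxE -val_eqE (ltn_eqF kn).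
Qed.

Lemma colsub_set_col S (n : 'I_M) v k (le : (k <= M)%N) : (k <= n)%N ->
  colsub (widen_ord le) (set_col S n v) = colsub (widen_ord le) S.
Proof.
move=> kn; apply/matrixP => i j; rewrite !mxE -val_eqE.
by rewrite (ltn_eqF (leq_trans (ltn_ord j) kn)).
Qed.

Lemma algA_choice_set_col S (n k : 'I_M) v Zp V l : (k <= n)%N ->
  @algA_choice R M gam S k Zp V l -> algA_choice gam (set_col S n v) Zp V l.
Proof.
by move=> kn; rewrite /algA_choice /algA_mx /first_cols colsub_set_col.
Qed.

Lemma algA_choice_exists S (k : 'I_M) : algA_inv gam S k ->
  exists Zp V l, algA_choice gam S Zp V l /\
    (k = 0%N :> nat -> [/\ Zp = pid_mx M, V = 1%:M & l = algA_gam2 gam (M - k)]).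
Proof.
move=> Sk; have [k0|k_gt0] := posnP k.
  by do 3!eexists; split; [exact: algA_choice0 | split].
have [Zu _] := Sk (ltnW (ltn_ord k)).
have [Zp [Zpu ZZp ZpP]] := orth_compl_exists (erefl (M - k)%N) Zu.
have Ah : algA_mx gam S Zp \is hermsymmx.
  apply/is_hermitianmxP; rewrite expr0 scale1r algA_mx_gram //.
  by rewrite [in RHS]adjmxM trmxCK.
have [V [l Ae]] := evd_exists Ah.
exists Zp, V, l; split; last by move=> k0; rewrite k0 in k_gt0.
split=> //; split=> // x; split=> [|[c ->]]; first exact: ZpP.
by rewrite mulmxA ZZp mul0mx.
Qed.

(** Induction from the zero matrix: step n writes column n only, and the bounds on the eigenvalues
    of A^(n) make the new column satisfy the invariant. *)
Lemma algA_partial n : (n < M)%N -> exists S : 'M[C]_M, algA_inv gam S n /\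
  forall k : 'I_M, (k < n)%N -> exists Zp V l, @algA_good M gam S k Zp V l.
Proof.
elim: n => [|n IH] nM; first by exists 0; split; first exact: algA_inv0.
have [S [Sn hS]] := IH (ltnW nM); pose k := Ordinal (ltnW nM).
have [Zp [V [l [ch d0]]]] := @algA_choice_exists S k Sn.
pose v := Zp *m V *m
  end_vec (M - k) (wt_fst (gam_mean gam) l`_0 l`_(M - k).-1)
                  (wt_lst (gam_mean gam) l`_0 l`_(M - k).-1).
have ch' := algA_choice_set_col v (leqnn k) ch.
exists (set_col S k v); split.
  apply: (@algA_step R M gam M_gt0 gam_gt0 _ k Zp V l nM _ ch' (col_set_col S k v)).
  by move=> le; rewrite colsub_set_col //; exact: Sn.
move=> k'; rewrite ltnS leq_eqVlt => /orP[/eqP k'n|k'n].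
  have -> : k' = k by apply: val_inj.
  by exists Zp, V, l; split; [exact: d0 | exact: ch' | rewrite col_set_col].
have [Zp' [V' [l' [d0' ch1 c1]]]] := hS k' k'n.
exists Zp', V', l'; split; first exact: d0'.
  exact: (@algA_choice_set_col S k k' v _ _ _ (ltnW k'n) ch1).
by rewrite col_set_col_lt ?cE ?c1.
Qed.

Lemma algorithmA_exists : exists S : 'M[C]_M, algorithmA gam S.
Proof.
have jM : (M.-1 < M)%N by rewrite ltn_predL.
pose j := Ordinal jM; have [M1|M1] := leqP M 1.
  have {M1} ME : M = 1%N by apply/eqP; rewrite eqn_leq M1.
  have k0 (k : 'I_M) : k = 0%N :> nat by case: k => -[|k] //=; rewrite ME.
  pose g := gam_mean gam.
  exists (set_col 0 j (end_vec M (wt_fst g (gam`_0 ^+ 2) (gam`_M.-1 ^+ 2))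
                                 (wt_lst g (gam`_0 ^+ 2) (gam`_M.-1 ^+ 2)))).
  exists (fun k => pid_mx M), (fun k => 1%:M), (fun k => algA_gam2 gam _).
  split=> //.
  - move=> k _; rewrite (_ : k = j) ?col_set_col //.
    by apply: val_inj; rewrite /= k0 ME.
  - by move=> k k_gt0; exfalso; move: k_gt0; rewrite k0.
  - by move=> k k_gt0; exfalso; move: k_gt0; rewrite k0.
  - by move=> k j' kE; exfalso; move: kE; rewrite k0 ME.
have [S [_ hS]] := algA_partial jM.
(* The complements, eigenvectors and eigenvalues are turned from one existence statement per k into
   functions of k by three finite choices, in order of dependence. *)
have [Zp hZp] : exists Zp : forall k : 'I_M, 'M[C]_(M, M - k), forall k : 'I_M,
    exists V l, (k < j)%N -> algA_good gam S (Zp k) V l.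
  apply: (@fin_all_exists 'I_M (fun k => 'M[C]_(M, M - k))
    (fun k Zp => exists V l, (k < j)%N ->
    @algA_good M gam S k Zp V l)) => k.
  (* At k = M - 1 no condition is imposed, and default values serve. *)
  have [kj|jk] := ltnP k j; last by exists 0, 0, (algA_gam2 gam _).
  by have [Zp [V [l h]]] := hS k kj; exists Zp, V, l.
have [V hV] := @fin_all_exists 'I_M (fun k => 'M[C]_(M - k))
  (fun k V => exists l, (k < j)%N ->
    @algA_good M gam S k (Zp k) V l) hZp.
have [l hl] := @fin_all_exists 'I_M (fun k => (M - k).-tuple R) (fun k l => (k < j)%N ->
    @algA_good M gam S k (Zp k) (V k) l) hV.
have kM : (M.-2 < M)%N by case: (M) M1 => [|[|m]] //= _; rewrite ltnW.
have kE : (M.-2.+2 = M)%N by case: (M) M1 => [|[|m]].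
pose k := Ordinal kM; pose g := gam_mean gam.
pose v := Zp k *m V k *m
  end_vec (M - k) (- wt_lst g (l k)`_0 (l k)`_1) (wt_fst g (l k)`_0 (l k)`_1).
have lt_j (k' : 'I_M) : (k'.+2 <= M)%N -> (k' < j)%N.
  by move=> h; rewrite /= -ltnS prednK.
have dot (k' : 'I_M) : (k' < j)%N -> algA_good gam (set_col S j v) (Zp k') (V k') (l k').
  move=> k'j; have [d0 ch cE] := hl k' k'j; split; first exact: d0.
    exact: algA_choice_set_col _ (ltnW k'j) ch.
  by rewrite col_set_col_lt ?cE ?c1.
exists (set_col S j v), Zp, V, l; split.
- move=> k' k'0 a z g'.
  have [/(_ k'0)[ZE VE lE] _ ->] : algA_good gam (set_col S j v) (Zp k') (V k') (l k').
    by apply/dot/lt_j; rewrite k'0.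
  by rewrite ZE VE lE algA_col0E.
- move=> k' k'0; have [d0 _ _] : algA_good gam (set_col S j v) (Zp k') (V k') (l k').
    by apply/dot/lt_j; rewrite k'0.
  exact: d0.
- by move=> k' _ /lt_j/dot[_ []].
- by move=> k' _ /lt_j/dot[_ _ ->].
- move=> k' j' k'E j'E a z g'.
  have -> : j' = j by apply: val_inj; apply: succn_inj; rewrite j'E /= prednK.
  rewrite col_set_col /v /a /z /g' -/g; suff -> : k' = k by [].
  by apply: val_inj; apply: succn_inj; apply: succn_inj; rewrite k'E /= kE.
Qed.

End AlgorithmA_runs.

(** * Constant diagonal of the R-factor *)

Section RFactor.
Variable R : realType.
Local Notation C := R[i].
Variable M : nat.
Variable gam : M.-tuple R.
Hypothesis M_gt0 : (0 < M)%N.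
Hypothesis gam_gt0 : forall i, 0 < tnth gam i.
Let G := tuple_mx gam.
Let g := gam_mean gam.

(** The last column follows a formula of its own, so the invariant at M is drawn from unitarity
    instead: the Gram determinant of G S is that of G. *)
Lemma algA_inv_full (S : 'M[C]_M) : S ^t* *m S = 1%:M -> algA_inv gam S M.
Proof.
move=> Su le_MM Z; have -> : Z = S.
  by apply/matrixP => i j; rewrite mxE; congr (S _ _); exact: val_inj.
split=> //; rewrite -(det_gram_gam gam M_gt0) adjmxM -mulmxA (mulmxA _ G).
by rewrite mulmxA det_congr_isometry.
Qed.

(** By triangularity the first k columns of [A] involve only the first k columns of [Q] and the
    leading block of [U]. *)
Lemma qr_prefix (A Q U : 'M[C]_M) k (le : (k <= M)%N) :
  (forall i j : 'I_M, (j < i)%N -> U i j = 0) -> A = Q *m U ->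
  colsub (widen_ord le) A =
  colsub (widen_ord le) Q *m mxsub (widen_ord le) (widen_ord le) U.
Proof.
move=> Uup ->; apply/matrixP => i j; rewrite !mxE (bigID (fun x : 'I_M => (x < k)%N)).
rewrite /= [X in _ + X]big1 ?addr0 => [|x kx]; last first.
  by rewrite Uup ?mulr0 // (leq_trans (ltn_ord j)) // leqNgt.
by rewrite (big_ord_narrow le); apply: eq_bigr => x _; rewrite !mxE.
Qed.

(** The invariant makes the product of the first k values |U_ii|^2 equal to g^k for every k.
    Consecutive quotients give |U_ii|^2 = g, and positivity of the diagonal selects the root. *)
Lemma qr_diag_algA (S Q U : 'M[C]_M) :
  (forall k, (k <= M)%N -> algA_inv gam S k) -> qr (G *m S) Q U ->
  forall i, U i i = (Num.sqrt g)%:C.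
Proof.
move=> Sinv [/unitarymxP/mulmx1C Qu Uup U_gt0 QU].
have minor k (le : (k <= M)%N) : \prod_(i < k)
    `|U (widen_ord le i) (widen_ord le i)| ^+ 2 = (g ^+ k)%:C.
  have [_ <-] := Sinv k le le.
  have GZ : G *m colsub (widen_ord le) S = colsub (widen_ord le) (G *m S).
    by apply/matrixP => x y; rewrite !mxE; apply: eq_bigr => z _; rewrite !mxE.
  rewrite GZ (det_gram_qr _ _ (qr_prefix le Uup QU)).
  - by apply: eq_bigr => i _; rewrite mxE.
  - apply/matrixP => x y.
    have /matrixP/(_ (widen_ord le x) (widen_ord le y)) := Qu.
    rewrite !mxE -val_eqE => <-.
    by apply: eq_bigr => z _; rewrite !mxE.
  - by move=> x y yx; rewrite mxE Uup.
move=> i; have := minor i.+1 (ltn_ord i); rewrite big_ord_recr /=.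
have -> : \prod_(j < i) `|U (widen_ord (ltn_ord i) (widen_ord (leqnSn i) j))
    (widen_ord (ltn_ord i) (widen_ord (leqnSn i) j))| ^+ 2 = (g ^+ i)%:C.
  rewrite -(minor i (ltnW (ltn_ord i))); apply: eq_bigr => j _.
  by congr (`|U _ _| ^+ 2); exact: val_inj.
have -> : widen_ord (ltn_ord i) ord_max = i by exact: val_inj.
have g_gt0 := gam_mean_gt0 gam_gt0.
have gi0 : ((g ^+ i)%:C : C) != 0 by rewrite fmorph_eq0 expf_neq0 // gt_eqF.
rewrite (exprSr g i) rmorphM => /(mulfI gi0); rewrite ger0_norm ?(ltW (U_gt0 _)) // => Ug.
apply/eqP; rewrite -(@eqrXn2 _ 2) ?(ltW (U_gt0 _)) //; last first.
  by rewrite ler0c sqrtr_ge0.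
by rewrite Ug -rmorphXn /= sqr_sqrtr // ltW.
Qed.

End RFactor.

(** * Inverse square roots, pseudo-inverses and QR of nonsingular matrices *)

Section PositiveDefinite.
Variable R : realType.
Local Notation C := R[i].

Lemma posdef_unit n (A : 'M[C]_n) : posdefmx A -> A \in unitmx.
Proof.
case=> _ h; rewrite unitmxE unitfE; apply/negP => /det0P[v v0 vA].
have x0 : v ^t* != 0.
  by apply: contraNneq v0 => e; rewrite -[v]trmxCK e trmx0 map_mx0.
by have := h _ x0; rewrite trmxCK vA mul0mx mxE ltxx.
Qed.

Lemma posdef_evd_gt0 n (A V : 'M[C]_n) (l : n.-tuple R) :
  posdefmx A -> evd A V l -> forall i, 0 < tnth l i.
Proof.
case=> _ Apos Ae i; rewrite -ltcR.
have [/unitarymxP Vu _ _] := Ae; have Ed := evd_diag Ae.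
have -> : (tnth l i)%:C = ((col i V) ^t* *m A *m col i V) 0 0.
  have -> : (tnth l i)%:C = (V ^t* *m A *m V) i i by rewrite Ed !mxE eqxx.
  rewrite -!mulmxA !mxE; apply: eq_bigr => k _; rewrite !mxE; congr (_ * _).
  by apply: eq_bigr => x _; rewrite !mxE.
apply: Apos; apply/negP => /eqP Vi0.
have := congr1 (fun X : 'M[C]_n => X i i) (mulmx1C Vu).
rewrite !mxE eqxx big1 => [/esym/eqP|k _]; first by rewrite oner_eq0.
by have := congr1 (fun X : 'cV[C]_n => X k 0) Vi0; rewrite !mxE => ->; rewrite mulr0.
Qed.

Lemma inv_sqrtmx_exists n (A : 'M[C]_n) : posdefmx A -> exists X, inv_sqrtmx A X.
Proof.
move=> Apos; have [Ah _] := Apos; have [V [l Ae]] := evd_exists Ah.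
have l_gt0 := posdef_evd_gt0 Apos Ae.
have [/unitarymxP Vu _ AE] := Ae; have Vu' := mulmx1C Vu.
(* [X] keeps the eigenvectors of [A] and replaces each eigenvalue by the inverse of its square
   root. *)
pose D := tuple_mx [tuple (Num.sqrt (tnth l i))^-1 | i < n].
pose X := V *m D *m V ^t*.
have DE i : 0 < (Num.sqrt (tnth l i))^-1 by rewrite invr_gt0 sqrtr_gt0.
exists X; split.
  split.
    apply/is_hermitianmxP; rewrite expr0 scale1r /X.
    have DA : D ^t* = D by exact: tuple_mx_adj.
    rewrite (adjmxM (V *m D)) (adjmxM V) (trmxCK V) DA mulmxA; reflexivity.
  move=> x x0; rewrite /X; pose y := V ^t* *m x.
  have -> : x ^t* *m (V *m D *m V ^t*) *m x = y ^t* *m D *m y.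
    by rewrite /y adjmxM trmxCK !mulmxA.
  have y0 : y != 0.
    by apply: contraNneq x0 => e; rewrite -[x]mul1mx -Vu -mulmxA -/y e mulmx0.
  have [i yi0] : exists i, y i 0 != 0.
    apply/existsP; apply: contraNT y0; rewrite negb_exists => /forallP h.
    by apply/eqP/matrixP => i j; rewrite ord1 [RHS]mxE; apply/eqP/negPn/h.
  have yE j : (y ^t* *m D) 0 j * y j 0 =
      `|y j 0| ^+ 2 * ((Num.sqrt (tnth l j))^-1)%:C.
    have yt : (y ^t*) 0 j = (y j 0)^*%R by rewrite mxE mxE.
    rewrite mul_mx_diag [X in X * _]mxE yt.
    by rewrite [X in _ * X * _]mxE tnth_mktuple normCK mulrAC [X in X * _]mulrC.
  rewrite mxE (bigD1 i) //= ltr_wpDr //.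
    apply: sumr_ge0 => j _; rewrite yE mulr_ge0 ?exprn_ge0 //.
    by rewrite ler0c ltW.
  by rewrite yE mulr_gt0 ?exprn_gt0 ?normr_gt0 // ltcR.
have E : A *m (X *m X) = 1%:M.
  rewrite AE /X !mulmxA -(mulmxA _ (V ^t*) V) Vu' mulmx1.
  rewrite -(mulmxA _ (V ^t*) V) Vu' mulmx1.
  suff -> : V *m tuple_mx l *m D *m D = V by [].
  rewrite -!mulmxA [X in V *m X](_ : _ = 1%:M) ?mulmx1 //.
  rewrite !mulmx_diag; apply/matrixP => i j; rewrite !mxE tnth_mktuple.
  have [_|//] := eqVneq; rewrite !mulr1n -!rmorphM /= -invfM -expr2 sqr_sqrtr.
    by rewrite divff // gt_eqF.
  exact/ltW.
by rewrite -[LHS]mul1mx -(mulVmx (posdef_unit Apos)) -mulmxA E mulmx1.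
Qed.

(** A^H A X = A^H (A X)^H = (A X A)^H = A^H, and A^H A is invertible. *)
Lemma mpinvmx_full_colE m n (A : 'M[C]_(m, n)) X : A ^t* *m A \in unitmx ->
  mpinvmx A X -> X = invmx (A ^t* *m A) *m A ^t*.
Proof.
move=> Nu [AXA _ AXh _].
rewrite -[LHS]mul1mx -(mulVmx Nu) -mulmxA; congr (_ *m _).
rewrite -mulmxA -[X in _ *m X]AXh.
by rewrite -adjmxM AXA.
Qed.

Lemma mpinvmx_full_col m n (A : 'M[C]_(m, n)) : A ^t* *m A \in unitmx ->
  mpinvmx A (invmx (A ^t* *m A) *m A ^t*).
Proof.
move=> Nu; set N := A ^t* *m A in Nu *.
have XA : invmx N *m A ^t* *m A = 1%:M by rewrite -mulmxA mulVmx.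
have Nh : (invmx N) ^t* = invmx N.
  by rewrite trmx_inv map_invmx -/(N ^t*) {1}/N adjmxM trmxCK.
split.
- by rewrite -mulmxA XA mulmx1.
- by rewrite XA mul1mx.
- by rewrite !adjmxM trmxCK Nh mulmxA.
- by rewrite XA adjmx1.
Qed.

Lemma qr_unit_exists n (A : 'M[C]_n) : A \in unitmx -> exists Q U, qr A Q U.
Proof.
move=> Au; have [Q [U [Qu Uup U_ge0 AE]]] := qr_exists A (leqnn n).
exists Q, U; split=> //; first by apply/unitarymxP/mulmx1C.
move=> i; rewrite lt_neqAle U_ge0 andbT eq_sym.
have : \det A != 0 by rewrite -unitfE -unitmxE.
by rewrite AE det_mulmx (det_upper Uup) mulf_eq0 negb_or => /andP[_ /prodf_neq0 ->].
Qed.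

End PositiveDefinite.

(** * Complementary error function and bit error rate *)

Section BitErrorRate.
Variable R : realType.

(** The tail integral is the total Gaussian integral minus the integral from minus infinity to x, to
    which the fundamental theorem of calculus applies. *)
Lemma is_derive_erfc (x : R) :
  is_derive x 1 (@erfc R) (- (2 / Num.sqrt pi * expR (- x ^+ 2))).
Proof.
have gint (i : interval R) :
    (@lebesgue_measure R).-integrable [set` i] (EFin \o (@gauss_fun R)).
  by apply: integrableS integrableT_gauss => //; exact: measurable_itv.
pose F (y : R) := \int[@lebesgue_measure R]_(t in [set` `]-oo, y]]) gauss_fun t.
pose T := \int[@lebesgue_measure R]_(t in [set` `]-oo, +oo[]) @gauss_fun R t.
have erfcE : @erfc R = fun y => 2 / Num.sqrt pi * (T - F y).
  apply/funext => y; rewrite /erfc; congr (_ * _).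
  rewrite -Rintegral_itv_obnd_cbnd; last exact: gint.
  by rewrite /T /F Rintegral_itvB //; exact: gint.
have [dF F'] : derivable F x 1 /\ F^`()%classic x = gauss_fun x.
  apply: (@continuous_FTC1 R gauss_fun -oo%O x (x + 1)) => //.
  - by rewrite ltrDl.
  - exact: ltNyr.
  - exact: continuous_gauss_fun.
have dFx : is_derive x 1 F (gauss_fun x).
  by split; [exact: dF | rewrite -derive1E; exact: F'].
have dZ := is_deriveZ (2 / Num.sqrt pi) (is_deriveB (is_derive_cst T x 1) dFx).
rewrite erfcE; apply: is_derive_eq dZ _; rewrite /gauss_fun /GRing.scale /=.
by rewrite sub0r mulrN.
Qed.

Lemma is_derive_inv_sqr (x : R) : 0 < x ->
  is_derive x 1 (fun y : R => (y ^+ 2)^-1) (- (2 / x ^+ 3)).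
Proof.
move=> x0; have x20 : x ^+ 2 != 0 by rewrite expf_neq0 // gt_eqF.
have dX : is_derive x 1 (fun y : R => y ^+ 2) (2 * x).
  have h := is_deriveM (is_derive_id x (1 : R)) (is_derive_id x (1 : R)).
  by apply: is_derive_eq h _; rewrite /GRing.scale /= mulr1 mulr2n mulrDl mul1r.
have [dXd dXv] := dX; split; first exact: derivableV.
rewrite deriveV // dXv /GRing.scale /=; field; exact: lt0r_neq0.
Qed.

(** The function v^3 exp(-v^2) decreases once v^2 is at least 3/2. The proof avoids derivatives and
    uses 1 + x <= exp x. *)
Lemma cube_gauss_le (c v : R) : 0 < c -> c <= v -> 3 / 2 <= c ^+ 2 ->
  v ^+ 3 * expR (- v ^+ 2) <= c ^+ 3 * expR (- c ^+ 2).
Proof.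
move=> c0 cv c2; have v0 : 0 < v := lt_le_trans c0 cv.
pose t := v ^+ 2 - c ^+ 2.
have t0 : 0 <= t by rewrite subr_ge0 ler_pXn2r // nnegrE ltW.
have vE : v ^+ 2 = c ^+ 2 + t by rewrite addrC subrK.
(* After 1 + x <= exp x there remains t <= (2/3) c^2 t, which is where c^2 >= 3/2 enters. *)
have h1 : v ^+ 2 <= c ^+ 2 * expR (2 / 3 * t).
  apply: le_trans (ler_wpM2l (sqr_ge0 c) (expR_ge1Dx _)); rewrite vE.
  nra.
(* The power 3/2 of the previous inequality, taken as a comparison of squares of cubes. *)
have h2 : (v ^+ 3) ^+ 2 <= (c ^+ 3 * expR t) ^+ 2.
  have swap (x : R) : (x ^+ 3) ^+ 2 = (x ^+ 2) ^+ 3 by rewrite -!exprM.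
  have expE : expR t ^+ 2 = expR (2 / 3 * t) ^+ 3.
    by rewrite -!expRM_natl; congr expR; field.
  rewrite (exprMn 2 (c ^+ 3)) !swap expE -(exprMn 3 (c ^+ 2)).
  by apply: lerXn2r; rewrite ?nnegrE ?sqr_ge0 // mulr_ge0 ?sqr_ge0 ?expR_ge0.
have h3 : v ^+ 3 <= c ^+ 3 * expR t.
  have cube_ge0 (x : R) : 0 < x -> 0 <= x ^+ 3 by move=> x0; rewrite exprn_ge0 // ltW.
  by rewrite -(@ler_pXn2r _ 2) // nnegrE ?cube_ge0 // mulr_ge0 ?cube_ge0 ?expR_ge0.
apply: le_trans (ler_wpM2r (expR_ge0 _) h3) _.
by rewrite -mulrA -expRD /t addrAC subrr sub0r.
Qed.

(* In the variable u^-2, erfc is convex for u^2 >= 3/2 and hence lies above its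
   tangents. *)
Lemma erfc_tangent (u v : R) : 0 < u -> 0 < v ->
  3 / 2 <= u ^+ 2 -> 3 / 2 <= v ^+ 2 ->
  erfc v + v ^+ 3 * expR (- v ^+ 2) / Num.sqrt pi * ((u ^+ 2)^-1 - (v ^+ 2)^-1)
  <= erfc u.
Proof.
(* [s] is the derivative of erfc with respect to x^-2 at x = v, the quotient of -2 exp(-v^2) / sqrt
   pi and -2 / v^3. The difference [D] from the tangent is to have its minimum at v. *)
move=> u0 v0 u2 v2; set s := v ^+ 3 * _ / _.
pose D (x : R) := erfc x - s * (x ^+ 2)^-1.
pose D' (x : R) := 2 / Num.sqrt pi / x ^+ 3 *
  (v ^+ 3 * expR (- v ^+ 2) - x ^+ 3 * expR (- x ^+ 2)).
have dD (x : R) : 0 < x -> is_derive x 1 D (D' x).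
  move=> x0; have dE := is_derive_erfc x; have dI := is_derive_inv_sqr x0.
  have dZ := is_deriveZ s dI.
  have dB := is_deriveB dE dZ.
  apply: is_derive_eq dB _; rewrite /GRing.scale /= /D' /s; field.
  by rewrite !gt_eqF // sqrtr_gt0 pi_gt0.
have k_gt0 (x : R) : 0 < x -> 0 <= 2 / Num.sqrt pi / x ^+ 3.
  by move=> x0; rewrite !divr_ge0 ?sqrtr_ge0 // exprn_ge0 // ltW.
suff : D v <= D u by rewrite /D; lra.
have cont (a b : R) : 0 < a -> {within `[a, b], continuous D}%classic.
  move=> a0; apply: derivable_within_continuous => x.
  rewrite in_itv /= => /andP[ax _].
  by have [] := dD x (lt_le_trans a0 ax).
(* Between u and v the sign of [D'] is given by [cube_gauss_le]: nonpositive to the left of v,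
   nonnegative to the right. The mean value theorem yields D v <= D u in both cases. *)
have [uv|vu] := ltP u v.
  have [x|] := MVT uv _ (cont _ _ u0) (df := D').
    by rewrite in_itv /= => /andP[ux _]; apply: dD; exact: lt_trans ux.
  move=> c; rewrite in_itv /= => /andP[uc cv] E.
  have c0 := lt_trans u0 uc.
  rewrite -subr_le0 E; apply: mulr_le0_ge0; last by rewrite subr_ge0 ltW.
  apply: mulr_ge0_le0; first exact: k_gt0.
  rewrite subr_le0; apply: cube_gauss_le => //; first exact: ltW.
  by apply: le_trans u2 _; rewrite ler_pXn2r ?nnegrE // ltW.
have [x|] := MVT_segment vu _ (cont _ _ v0) (df := D').
  by rewrite in_itv /= => /andP[ux _]; apply: dD; exact: lt_trans ux.
move=> c; rewrite in_itv /= => /andP[vc cu] E.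
have c0 := lt_le_trans v0 vc.
rewrite -subr_ge0 E; apply: mulr_ge0; last by rewrite subr_ge0.
apply: mulr_ge0; first exact: k_gt0.
by rewrite subr_ge0; apply: cube_gauss_le.
Qed.

Lemma sqrt4X b : Num.sqrt (4 ^+ b) = 2 ^+ b :> R.
Proof.
have -> : 4 = 2 ^+ 2 :> R by rewrite -natrX.
by rewrite -exprM mulnC exprM sqrtr_sqr ger0_norm // exprn_ge0.
Qed.

(** * Tangents to the bit error rate of one symbol *)

Section Constants.
Variable b : nat.
Hypothesis b_ge1 : (1 <= b)%N.

Let pow2b : 2 <= 2 ^+ b :> R.
Proof. by rewrite -[leLHS]expr1 ler_weXn2l // ler1n. Qed.

Lemma ber_alpha_ge0 : 0 <= ber_alpha R b.
Proof.
rewrite /ber_alpha sqrt4X divr_ge0 ?mulr_ge0 ?exprn_ge0 // subr_ge0.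
by apply: le_trans pow2b; rewrite ler1n.
Qed.

Lemma ber_zeta_ge0 : 0 <= ber_zeta R b.
Proof. by rewrite /ber_zeta sqrt4X divr_ge0 ?mulr_ge0 ?exprn_ge0 // subr_ge0. Qed.

Lemma ber_beta_gt0 : 0 < ber_beta R b.
Proof.
rewrite /ber_beta divr_gt0 ?mulr_gt0 ?ltr0n // subr_gt0.
by rewrite exprn_egt1 // ?ltr1n // -lt0n.
Qed.

Definition ber_term (x : R) : R :=
  ber_alpha R b * erfc (Num.sqrt (ber_beta R b / x))
  + ber_zeta R b * erfc (3 * Num.sqrt (ber_beta R b / x)).

(** The condition x < 2 beta / 3 says that r^2 = beta / x exceeds 3/2, so [erfc_tangent] applies at
    r and at 3 r. The sign of [s] matters because the mean error is only bounded below by y. *)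
Lemma ber_term_tangent (y : R) : 0 < y < 2 * ber_beta R b / 3 ->
  exists2 s : R, 0 <= s & forall x, 0 < x < 2 * ber_beta R b / 3 ->
    ber_term y + s * (x - y) <= ber_term x.
Proof.
set be := ber_beta R b; have be0 : 0 < be := ber_beta_gt0.
have al0 := ber_alpha_ge0; have ze0 := ber_zeta_ge0.
pose r (x : R) := Num.sqrt (be / x).
pose slope (v : R) := v ^+ 3 * expR (- v ^+ 2) / Num.sqrt (pi : R).
have r_gt0 (x : R) : 0 < x -> 0 < r x by move=> x0; rewrite sqrtr_gt0 divr_gt0.
have r2 (x : R) : 0 < x -> r x ^+ 2 = be / x.
  by move=> x0; rewrite sqr_sqrtr // divr_ge0 // ltW.
have r_ge (x : R) : 0 < x < 2 * be / 3 -> 3 / 2 <= r x ^+ 2.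
  by move=> /andP[x0 xb]; rewrite r2 // ler_pdivlMr //; lra.
have slope_ge0 (v : R) : 0 < v -> 0 <= slope v.
  move=> v0; rewrite divr_ge0 ?sqrtr_ge0 // mulr_ge0 ?expR_ge0 //.
  by rewrite exprn_ge0 // ltW.
move=> yb; have /andP[y0 _] := yb.
(* The divisors beta and 9 beta come from r^-2 = x / beta and (3 r)^-2 = x / (9 beta). *)
exists (ber_alpha R b * (slope (r y) / be) + ber_zeta R b * (slope (3 * r y) / (9 * be))).
  have r3 : 0 < 3 * r y by rewrite mulr_gt0 ?r_gt0.
  have be9 : 0 <= 9 * be by rewrite mulr_ge0 // ltW.
  apply: addr_ge0; apply: mulr_ge0 => //; apply: divr_ge0 => //.
  - by apply: slope_ge0; exact: r_gt0.
  - exact: ltW.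
  - exact: slope_ge0.
move=> x xb; have /andP[x0 _] := xb.
have h1 := erfc_tangent (r_gt0 x x0) (r_gt0 y y0) (r_ge x xb) (r_ge y yb).
have nine (z : R) : 0 < z < 2 * be / 3 -> 3 / 2 <= (3 * r z) ^+ 2.
  by move=> zb; have := r_ge z zb; rewrite exprMn; lra.
have three (z : R) : 0 < z -> 0 < 3 * r z by move=> z0; rewrite mulr_gt0 ?r_gt0.
have h2 := erfc_tangent (three x x0) (three y y0) (nine x xb) (nine y yb).
have e1 : (r x ^+ 2)^-1 - (r y ^+ 2)^-1 = (x - y) / be.
  by rewrite !r2 // !invf_div -mulrBl.
have e2 : ((3 * r x) ^+ 2)^-1 - ((3 * r y) ^+ 2)^-1 = (x - y) / (9 * be).
  rewrite !(exprMn 2 3) !r2 //; field; by rewrite !lt0r_neq0.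
rewrite e1 in h1; rewrite e2 in h2.
apply: le_trans (lerD (ler_wpM2l al0 h1) (ler_wpM2l ze0 h2)).
rewrite /ber_term -/be -!/(r _) -!/(slope _) le_eqVlt; apply/orP; left; apply/eqP.
field; exact: lt0r_neq0.
Qed.

End Constants.
End BitErrorRate.

(** * Zero-forcing transceivers *)

Section ZF.
Variable R : realType.
Local Notation C := R[i].
Variables P K M : nat.
Variables (p0 : R) (H : 'M[C]_(P, K)) (Rvv : 'M[C]_P).
Variables (V : 'M[C]_K) (lam : K.-tuple R).
Hypothesis M_gt0 : (0 < M)%N.
Hypothesis leMP : (M <= P)%N.
Hypothesis leMK : (M <= K)%N.
Hypothesis p0_gt0 : 0 < p0.
Hypothesis rankH : (M <= \rank H)%N.
Hypothesis Rvv_posdef : posdefmx Rvv.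
Hypothesis lam_evd : evd (ZF_gram H Rvv) V lam.

Let w := widen_ord leMK.

Lemma inv_sqrtmx_whiten Rh : inv_sqrtmx Rvv Rh ->
  [/\ Rh ^t* = Rh, Rh \in unitmx & Rh *m Rvv *m Rh = 1%:M].
Proof.
case=> -[/is_hermitianmxP Rhh Rh_pos] RhE; split.
- by rewrite [RHS]Rhh expr0 scale1r.
- by apply: posdef_unit; split=> //; exact/is_hermitianmxP.
by apply: mulmx1C; rewrite mulmxA RhE mulVmx // posdef_unit.
Qed.

Lemma gram_whitened Rh n (F : 'M[C]_(K, n)) : inv_sqrtmx Rvv Rh ->
  (Rh *m H *m F) ^t* *m (Rh *m H *m F) = F ^t* *m ZF_gram H Rvv *m F.
Proof.
move=> hRh; have [Rhh _ _] := inv_sqrtmx_whiten hRh; case: hRh => _ RhE.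
by rewrite !adjmxM Rhh /ZF_gram -RhE !mulmxA.
Qed.

Lemma lam_ge0 i : 0 <= tnth lam i.
Proof.
have [Rh hRh] := inv_sqrtmx_exists Rvv_posdef.
have := lam_evd; have := gram_whitened 1%:M hRh.
by rewrite adjmx1 mul1mx !mulmx1 => <- /evd_gram_ge0.
Qed.

(* If lam_M = 0, then all but the first M - 1 columns of R_vv^(-1/2) H V vanish. *)
Lemma lam_gt0 (i : 'I_M) : 0 < lam`_i.
Proof.
have [_ lam_sorted _] := lam_evd; have [/unitarymxP Vu _ _] := lam_evd.
have iK : (i < K)%N := leq_trans (ltn_ord i) leMK.
have lE (j : 'I_K) : lam`_j = tnth lam j by rewrite (tnth_nth 0).
rewrite lt_neqAle -[i : nat]/(val (Ordinal iK)) lE lam_ge0 andbT eq_sym.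
apply/negP => /eqP li0.
have [Rh hRh] := inv_sqrtmx_exists Rvv_posdef.
have [_ Rhu _] := inv_sqrtmx_whiten hRh.
pose E := Rh *m H *m V.
have EE : E ^t* *m E = tuple_mx lam by rewrite gram_whitened // (evd_diag lam_evd).
have E0 (j : 'I_K) : (i <= j)%N -> forall k, E k j = 0.
  move=> ij; apply: gram_eq0; rewrite EE !mxE eqxx mulr1n.
  suff -> : tnth lam j = 0 by [].
  apply/le_anti; rewrite lam_ge0 andbT -li0 -!lE.
  by apply: sorted_ge_nth; rewrite ?ij ?ltn_ord.
have EP : E = E *m (pid_mx i : 'M[C]_K).
  apply/matrixP => x j; rewrite [RHS]mxE (bigD1 j) //= big1 => [|y yj].
    rewrite [X in _ * X]mxE eqxx addr0 /=; case: ltnP => ji; first by rewrite mulr1.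
    by rewrite E0 // mul0r.
  by rewrite [X in _ * X]mxE val_eqE (negPf yj) mulr0.
(* [E] has the rank of [H], its outer factors being invertible, while at most its first i columns
   are nonzero. *)
have : (M <= i)%N.
  apply: leq_trans rankH _.
  have -> : \rank H = \rank E.
    rewrite /E mxrankMfree ?row_free_unit; last by case/mulmx1_unit: Vu.
    by rewrite eqmxMfull // row_full_unit.
  rewrite EP; apply: leq_trans (mxrankM_maxr _ _) _.
  by rewrite rank_pid_mx // ltnW.
by rewrite leqNgt ltn_ord.
Qed.

Let P0 := \prod_(i < M) lam`_i.

Lemma prod_lam_gt0 : 0 < P0.
Proof. by apply: prodr_gt0 => i _; exact: lam_gt0. Qed.

Lemma err_cov_whitened Rh n (W : 'M[C]_(n, P)) : inv_sqrtmx Rvv Rh ->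
  err_cov Rvv W = (W *m invmx Rh) *m (W *m invmx Rh) ^t*.
Proof.
move=> hRh; have [Rhh Rhu RhR] := inv_sqrtmx_whiten hRh.
rewrite adjmxM trmx_inv map_invmx -/(Rh ^t*) Rhh /err_cov.
rewrite -[in LHS](mulmxK Rhu Rvv) -[Rvv *m Rh](mulKmx Rhu).
by rewrite (mulmxA Rh) RhR mulmx1 !mulmxA.
Qed.

Lemma err_cov_mse n (W : 'M[C]_(n, P)) i :
  err_cov Rvv W i i = (mse (err_cov Rvv W) i)%:C.
Proof.
have [Rh hRh] := inv_sqrtmx_exists Rvv_posdef.
rewrite /mse RRe_real // (err_cov_whitened _ hRh) gram_diagr ger0_real //.
by apply: sumr_ge0 => k _; rewrite exprn_ge0.
Qed.

Lemma amseE n (W : 'M[C]_(n, P)) :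
  amse (err_cov Rvv W) = (\sum_i mse (err_cov Rvv W) i) / n%:R.
Proof.
rewrite /amse /mxtrace; congr (_ / _).
have -> : \sum_i err_cov Rvv W i i = (\sum_i mse (err_cov Rvv W) i)%:C.
  by rewrite rmorph_sum; apply: eq_bigr => i _; rewrite err_cov_mse.
by [].
Qed.

(** Passing from [F] to V^H F keeps the trace and turns the channel Gram matrix into diag lam, to
    which [det_gram_weighted_le] applies. *)
Lemma ZF_gram_det_le (F : 'M[C]_(K, M)) : \tr (F *m F ^t*) <= p0%:C ->
  \det (F ^t* *m ZF_gram H Rvv *m F) <= (P0 * (p0 / M%:R) ^+ M)%:C.
Proof.
move=> trF; have [/unitarymxP Vu lam_sorted ->] := lam_evd.
have -> : F ^t* *m (V *m tuple_mx lam *m V ^t*) *m F =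
    (V ^t* *m F) ^t* *m tuple_mx lam *m (V ^t* *m F).
  by rewrite adjmxM trmxCK !mulmxA.
apply: le_trans (det_gram_weighted_le leMK _ _ _) _.
- by move=> i; rewrite ler0c lam_ge0.
- move=> i j ij; rewrite lecR !(tnth_nth 0).
  by apply: sorted_ge_nth; rewrite ?ij ?ltn_ord.
have -> : \tr (V ^t* *m F *m (V ^t* *m F) ^t*) = \tr (F *m F ^t*).
  by rewrite adjmxM trmxCK mxtrace_mulC -!mulmxA (mulmxA V) Vu mul1mx mxtrace_mulC.
have -> : \prod_(i < M) (tnth lam (widen_ord leMK i))%:C = P0%:C :> C.
  by rewrite rmorph_prod; apply: eq_bigr => i _; rewrite (tnth_nth 0).
rewrite rmorphM /=; apply: ler_wpM2l; first by rewrite ler0c ltW ?prod_lam_gt0.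
have -> : ((p0 / M%:R) ^+ M)%:C = (p0%:C / M%:R) ^+ M :> C.
  by rewrite rmorphXn rmorphM fmorphV rmorph_nat.
have M0 : (0 : C) <= M%:R^-1 by rewrite invr_ge0 ler0n.
apply: lerXn2r; rewrite ?nnegrE.
- apply: mulr_ge0 => //; apply: sumr_ge0 => i _; rewrite gram_diagr.
  by apply: sumr_ge0 => k _; rewrite exprn_ge0.
- by apply: mulr_ge0 => //; rewrite ler0c ltW.
exact: ler_wpM2r.
Qed.

(** The value sigma_e^2; its M-th power is the inverse of the bound in [ZF_gram_det_le]. *)
Definition ZF_var : R := M%:R / p0 * P0 `^ (- M%:R^-1).

Lemma ZF_var_expn : ZF_var ^+ M * (P0 * (p0 / M%:R) ^+ M) = 1.
Proof.
rewrite /ZF_var exprMn -[(P0 `^ _) ^+ M]powR_mulrn ?powR_ge0 // -powRrM.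
have M0 : M%:R != 0 :> R by rewrite pnatr_eq0 -lt0n.
rewrite mulNr mulVf // powRN powRr1 ?(ltW prod_lam_gt0) // mulrACA mulrC.
rewrite !exprMn !exprVn; field.
by rewrite !expf_neq0 ?(gt_eqF p0_gt0) // (gt_eqF prod_lam_gt0).
Qed.

(** After whitening, [det_gram_mul_prod_ge1] and the determinant bound give a lower bound on the
    product of the error variances, which makes each of them positive. AM-GM passes to their mean,
    by comparison of M-th powers. *)
Lemma ZF_BDFD_mse_bound F B W : @ZF_BDFD R P K M p0 H F B W ->
  (forall i, 0 < mse (err_cov Rvv W) i) /\
  ZF_var <= (\sum_i mse (err_cov Rvv W) i) / M%:R.
Proof.
case=> Bup trF WHF.
have [Rh hRh] := inv_sqrtmx_exists Rvv_posdef.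
have [Rhh Rhu RhR] := inv_sqrtmx_whiten hRh.
pose x i := mse (err_cov Rvv W) i.
have YA : (W *m invmx Rh) *m (Rh *m H *m F) = B + 1%:M.
  by rewrite !mulmxA mulmxKV.
have [] := det_gram_mul_prod_ge1 leMP _ _ YA.
- by move=> i j ji; rewrite !mxE Bup ?(ltnW ji) // add0r -val_eqE (gtn_eqF ji).
- by move=> i; rewrite !mxE Bup // add0r eqxx.
rewrite gram_whitened // -err_cov_whitened //.
have -> : \prod_i err_cov Rvv W i i = (\prod_i x i)%:C.
  by rewrite rmorph_prod; apply: eq_bigr => i _; rewrite err_cov_mse.
set D := \det _ => D_gt0 D_ge.
have x_ge0 i : 0 <= x i.
  rewrite -ler0c -err_cov_mse (err_cov_whitened _ hRh) gram_diagr.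
  by apply: sumr_ge0 => k _; rewrite exprn_ge0.
have xP_ge0 : 0 <= \prod_i x i by apply: prodr_ge0.
have bound : 1 <= P0 * (p0 / M%:R) ^+ M * \prod_i x i.
  rewrite -lecR; apply: le_trans D_ge _; rewrite rmorphM /=.
  by apply: ler_wpM2r; [rewrite ler0c | exact: ZF_gram_det_le].
have xP_gt0 : 0 < \prod_i x i.
  rewrite lt_neqAle xP_ge0 andbT eq_sym; apply/negP => /eqP x0.
  by move: bound; rewrite x0 mulr0 ler10.
split.
  move=> i; rewrite lt_neqAle x_ge0 andbT eq_sym.
  by move: xP_gt0 => /lt0r_neq0/prodf_neq0 /(_ i isT).
have M0 : (0 : R) < M%:R by rewrite ltr0n.
have var_ge0 : 0 <= ZF_var by rewrite mulr_ge0 ?powR_ge0 // divr_ge0 // ltW.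
have sum_ge0 : 0 <= (\sum_i x i) / M%:R by rewrite divr_ge0 ?sumr_ge0 // ltW.
rewrite -(@ler_pXn2r _ M) ?nnegrE //.
have agm : \prod_i x i <= ((\sum_i x i) / M%:R) ^+ M.
  have [+ _] := leif_AGM (A := 'I_M) (E := x) (fun i _ => x_ge0 i).
  by rewrite card_ord.
apply: le_trans agm.
have Q_gt0 : 0 < P0 * (p0 / M%:R) ^+ M.
  by rewrite mulr_gt0 ?prod_lam_gt0 // exprn_gt0 // divr_gt0.
by rewrite -(ler_pM2l Q_gt0) mulrC ZF_var_expn.
Qed.

(** * Attainment of the bound by the ZF design *)

Let gam : M.-tuple R := [tuple Num.sqrt lam`_i | i < M].

Lemma ZF_gam_gt0 i : 0 < tnth gam i.
Proof. by rewrite tnth_mktuple sqrtr_gt0 lam_gt0. Qed.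

Lemma ZF_gam_sorted : sorted >=%R gam.
Proof.
have [_ lam_sorted _] := lam_evd.
apply: (@sorted_mktuple R M (fun i => Num.sqrt lam`_i)) => i j /andP[ij jM].
by apply: ler_wsqrtr; apply: sorted_ge_nth; rewrite ?ij ?(leq_trans jM).
Qed.

Lemma ZF_gam_mean : gam_mean gam = P0 `^ M%:R^-1.
Proof.
rewrite /gam_mean; congr (_ `^ _); apply: eq_bigr => i _.
by rewrite tnth_mktuple sqr_sqrtr // ltW // lam_gt0.
Qed.

Let VM := colsub w V.

Lemma first_eigvecs_isometry : VM ^t* *m VM = 1%:M.
Proof.
have [/unitarymxP/mulmx1C Vu _ _] := lam_evd; apply/matrixP => i j.
have /matrixP/(_ (w i) (w j)) := Vu; rewrite !mxE -val_eqE => <-.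
by apply: eq_bigr => k _; rewrite !mxE.
Qed.

Lemma first_eigvecs_gram :
  VM ^t* *m ZF_gram H Rvv *m VM = (tuple_mx gam) ^t* *m tuple_mx gam.
Proof.
rewrite tuple_mx_adj mulmx_diag; apply/matrixP => i j.
have -> : (VM ^t* *m ZF_gram H Rvv *m VM) i j =
    (V ^t* *m ZF_gram H Rvv *m V) (w i) (w j).
  rewrite !mxE; apply: eq_bigr => k _; rewrite !mxE; congr (_ * _).
  by apply: eq_bigr => x _; rewrite !mxE.
rewrite (evd_diag lam_evd) !mxE tnth_mktuple -val_eqE /= val_eqE -rmorphM /=.
by rewrite -expr2 sqr_sqrtr ?(ltW (lam_gt0 _)) // (tnth_nth 0).
Qed.

(** On the first M eigenvectors the channel Gram matrix is Gamma^2, so after [Psi] it becomes (Gamma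
    Psi)^H (Gamma Psi) = U^H U. The power is spread evenly because [Psi] is unitary. *)
Lemma ZF_precoder_gram Psi Q U F :
  algorithmA gam Psi -> qr (tuple_mx gam *m Psi) Q U ->
  F = (Num.sqrt (p0 / M%:R))%:C *: (VM *m Psi) ->
  [/\ F ^t* *m F = (p0 / M%:R)%:C%:M,
      F ^t* *m ZF_gram H Rvv *m F = (p0 / M%:R)%:C *: (U ^t* *m U),
      U \in unitmx &
      forall i, U i i = (Num.sqrt (gam_mean gam))%:C].
Proof.
move=> [Zp [Vr [l run]]] Uqr ->.
have Psiu := algA_run_unitary M_gt0 ZF_gam_gt0 ZF_gam_sorted run.
have Psi_inv k : (k <= M)%N -> algA_inv gam Psi k.
  rewrite leq_eqVlt => /orP[/eqP ->|kM].
    exact: algA_inv_full.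
  exact: (algA_run_inv M_gt0 ZF_gam_gt0 ZF_gam_sorted run kM).
have Uii := qr_diag_algA ZF_gam_gt0 Psi_inv Uqr.
have [/unitarymxP/mulmx1C Qu Uup U_gt0 QU] := Uqr.
have cc : (Num.sqrt (p0 / M%:R))%:C^*%R * (Num.sqrt (p0 / M%:R))%:C
    = (p0 / M%:R)%:C :> C.
  rewrite (@conj_Creal C) ?complex_real // -rmorphM -expr2 /= sqr_sqrtr //.
  by rewrite divr_ge0 // ltW.
split=> //.
- rewrite adjmxZ -scalemxAr -scalemxAl scalerA mulrC cc adjmxM -mulmxA.
  by rewrite (mulmxA _ VM) first_eigvecs_isometry mul1mx Psiu scalemx1.
- rewrite adjmxZ -scalemxAr -!scalemxAl scalerA mulrC cc; congr (_ *: _).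
  have -> : (VM *m Psi) ^t* *m ZF_gram H Rvv *m (VM *m Psi) =
      Psi ^t* *m (VM ^t* *m ZF_gram H Rvv *m VM) *m Psi by rewrite adjmxM !mulmxA.
  rewrite first_eigvecs_gram.
  have -> : Psi ^t* *m ((tuple_mx gam) ^t* *m tuple_mx gam) *m Psi =
      (tuple_mx gam *m Psi) ^t* *m (tuple_mx gam *m Psi).
    by rewrite adjmxM !mulmxA.
  by rewrite QU adjmxM -mulmxA (mulmxA _ Q) Qu mul1mx.
rewrite unitmxE unitfE (det_upper Uup); apply/prodf_neq0 => i _.
by rewrite gt_eqF.
Qed.

Lemma scaled_gram_unit (U : 'M[C]_M) : U \in unitmx ->
  (p0 / M%:R)%:C *: (U ^t* *m U) \in unitmx.
Proof.
move=> Uu; rewrite unitmxZ ?unitmx_mul ?map_unitmx ?unitmx_tr ?Uu //.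
by rewrite unitfE fmorph_eq0 mulf_neq0 ?invr_eq0 ?pnatr_eq0 -?lt0n ?gt_eqF.
Qed.

Lemma ZF_design_exists : exists F B W, ZF_design leMK p0 H Rvv V lam F B W.
Proof.
have [Psi alg] := algorithmA_exists M_gt0 ZF_gam_gt0 ZF_gam_sorted.
have [Rh hRh] := inv_sqrtmx_exists Rvv_posdef.
have [Q [U Uqr]] : exists Q U, qr (tuple_mx gam *m Psi) Q U.
  apply: qr_unit_exists; rewrite unitmx_mul; apply/andP; split.
    rewrite unitmxE unitfE det_tuple_mx fmorph_eq0.
    by apply/prodf_neq0 => i _; rewrite gt_eqF // ZF_gam_gt0.
  have [Zp [Vr [l run]]] := alg.
  by have /mulmx1_unit[] := algA_run_unitary M_gt0 ZF_gam_gt0 ZF_gam_sorted run.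
pose F := (Num.sqrt (p0 / M%:R))%:C *: (VM *m Psi).
have [_ FNF Uu _] := ZF_precoder_gram alg Uqr (erefl F).
have Nu : (Rh *m H *m F) ^t* *m (Rh *m H *m F) \in unitmx.
  by rewrite gram_whitened // FNF scaled_gram_unit.
pose B := ((\prod_(i < M) lam`_i) `^ (- (2 * M)%:R^-1))%:C *: U - 1%:M.
pose X := invmx ((Rh *m H *m F) ^t* *m (Rh *m H *m F)) *m (Rh *m H *m F) ^t*.
exists F, B, ((B + 1%:M) *m X *m Rh), Psi, Q, U, Rh, X.
by split; split=> //; exact: mpinvmx_full_col.
Qed.

(** The scaling of [U] in [B] is the inverse of the constant diagonal entry of [U], which gives B +
    I a unit diagonal. *)
Lemma ZF_scale_sqrt : P0 `^ (- (2 * M)%:R^-1) = (Num.sqrt (gam_mean gam))^-1.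
Proof.
rewrite powRN ZF_gam_mean -powR12_sqrt ?powR_ge0 // -powRrM natrM invfM.
by rewrite mulrC.
Qed.

(** [X] is a left inverse of the whitened channel [A], hence zero forcing, and X X^H = (A^H A)^-1.
    The error covariance is therefore g^-1 U (A^H A)^-1 U^H, and A^H A = (p0 / M) U^H U makes it a
    scalar matrix. *)
Lemma ZF_design_correct F B W : ZF_design leMK p0 H Rvv V lam F B W ->
  ZF_BDFD p0 H F B W /\ err_cov Rvv W = ZF_var%:C%:M.
Proof.
move=> [Psi [Q [U [Rh [X [[alg Uqr FE BE] [hRh hX WE]]]]]]].
have [FF FNF Uu Uii] := ZF_precoder_gram alg Uqr FE.
have [Rhh Rhu RhR] := inv_sqrtmx_whiten hRh.
have [_ Uup _ _] := Uqr.
set A := Rh *m H *m F in hX.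
have AA : A ^t* *m A = (p0 / M%:R)%:C *: (U ^t* *m U) by rewrite gram_whitened.
have Nu : A ^t* *m A \in unitmx by rewrite AA scaled_gram_unit.
have XE := mpinvmx_full_colE Nu hX.
have XA : X *m A = 1%:M by rewrite XE -mulmxA mulVmx.
have sg_gt0 : 0 < Num.sqrt (gam_mean gam).
  by rewrite sqrtr_gt0 gam_mean_gt0 //; exact: ZF_gam_gt0.
have M0 : M%:R != 0 :> R by rewrite pnatr_eq0 -lt0n.
have B1 : B + 1%:M = ((Num.sqrt (gam_mean gam))^-1)%:C *: U.
  by rewrite BE subrK -ZF_scale_sqrt.
split.
  split.
  - move=> i j; rewrite leq_eqVlt => /orP[/eqP/val_inj ->|ji].
      have -> : B i i = (B + 1%:M) i i - 1.
        by rewrite [(B + _) i i]mxE [(1%:M) i i]mxE eqxx addrK.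
      by rewrite B1 mxE Uii -rmorphM /= mulVf ?subrr // gt_eqF.
    have -> : B i j = (B + 1%:M) i j.
      by rewrite [RHS]mxE [(1%:M) i j]mxE -val_eqE (gtn_eqF ji) addr0.
    by rewrite B1 mxE Uup // mulr0.
  - by rewrite mxtrace_mulC FF mxtrace_scalar -rmorphMn /= -mulr_natr divfK.
  - by rewrite WE -!mulmxA (mulmxA Rh) XA mulmx1.
have XX : X *m X ^t* = invmx (A ^t* *m A).
  have Nh : (A ^t* *m A) ^t* = A ^t* *m A by rewrite (adjmxM (A ^t*)) (trmxCK A).
  rewrite XE (adjmxM (invmx _)) (trmxCK A) mulmxA -(mulmxA _ (A ^t*) A).
  by rewrite mulVmx // mul1mx trmx_inv map_invmx Nh.
have k0 : (p0 / M%:R)%:C != 0 :> C.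
  by rewrite fmorph_eq0 mulf_neq0 ?invr_eq0 // gt_eqF.
have UYU : U *m invmx (A ^t* *m A) *m U ^t* = ((p0 / M%:R)%:C^-1)%:M.
  have h : U *m invmx (A ^t* *m A) *m U ^t* *m U = (p0 / M%:R)%:C^-1 *: U.
    have -> : U *m invmx (A ^t* *m A) *m U ^t* *m U =
        (p0 / M%:R)%:C^-1 *: (U *m invmx (A ^t* *m A) *m (A ^t* *m A)).
      by rewrite {3}AA -scalemxAr scalerA mulVf // scale1r !mulmxA.
    by rewrite mulmxKV.
  by rewrite -[LHS](mulmxK Uu) h -scalemxAl mulmxV // scalemx1.
rewrite /err_cov WE !adjmxM Rhh.
have -> : (B + 1%:M) *m X *m Rh *m Rvv *m (Rh *m (X ^t* *m (B + 1%:M) ^t*)) =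
    (B + 1%:M) *m (X *m (Rh *m Rvv *m Rh) *m X ^t*) *m (B + 1%:M) ^t*.
  by rewrite !mulmxA.
rewrite RhR mulmx1 XX B1 adjmxZ -!scalemxAl -scalemxAr scalerA UYU.
rewrite (@conj_Creal C) ?complex_real // -rmorphM /=.
rewrite -fmorphV scale_scalar_mx -rmorphM /=; congr (_%:C%:M).
rewrite -invfM -expr2 sqr_sqrtr; last first.
  by rewrite ltW // gam_mean_gt0 //; exact: ZF_gam_gt0.
by rewrite /ZF_var powRN -ZF_gam_mean invf_div mulrC.
Qed.

Lemma ZF_var_gt0 : 0 < ZF_var.
Proof. by rewrite mulr_gt0 ?divr_gt0 ?ltr0n ?powR_gt0 ?prod_lam_gt0. Qed.

Lemma ZF_ber_le b (F' : 'M[C]_(K, M)) (B' : 'M[C]_M) (W' : 'M[C]_(M, P))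
    (Ree : 'M[C]_M) : (1 <= b)%N ->
  Ree = ZF_var%:C%:M -> ZF_BDFD p0 H F' B' W' ->
  mod_high_SNR b (err_cov Rvv W') ->
  mod_high_SNR b Ree /\ ber b Ree <= ber b (err_cov Rvv W').
Proof.
move=> b_ge1 ReeE zf snr; have [x_gt0 var_le] := ZF_BDFD_mse_bound zf.
have M0 : (0 : R) < M%:R by rewrite ltr0n.
have mseE i : mse Ree i = ZF_var by rewrite /mse ReeE mxE eqxx mulr1n.
(* The design inherits the SNR regime from the competitor: sigma_e^2 is at most the mean of its
   error variances, all below 2 beta / 3. *)
have var_lt : ZF_var < 2 * ber_beta R b / 3.
  apply: le_lt_trans var_le _; rewrite ltr_pdivrMr //.
  have -> : 2 * ber_beta R b / 3 * M%:R = \sum_(i < M) (2 * ber_beta R b / 3).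
    by rewrite sumr_const card_ord mulr_natr.
  apply: ltr_sum => [|i _]; last exact: snr.
  by apply/hasP; exists (Ordinal M_gt0) => //; exact: mem_index_enum.
split; first by move=> i; rewrite mseE.
have [s s_ge0 tangent] := ber_term_tangent b_ge1 (introT andP (conj ZF_var_gt0 var_lt)).
rewrite /ber; apply: ler_wpM2l; first by rewrite invr_ge0 ltW.
have -> : \sum_(i < M) (ber_alpha R b * erfc (Num.sqrt (ber_beta R b / mse Ree i))
    + ber_zeta R b * erfc (3 * Num.sqrt (ber_beta R b / mse Ree i))) =
    \sum_(i < M) ber_term b ZF_var.
  by apply: eq_bigr => i _; rewrite mseE.
(* The summed linear terms are s times the excess of the total error over M sigma_e^2, which is
   nonnegative. *)
apply: (@le_trans _ _ (\sum_(i < M)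
    (ber_term b ZF_var + s * (mse (err_cov Rvv W') i - ZF_var)))).
  rewrite [leRHS]big_split /= lerDl -mulr_sumr mulr_ge0 // sumrB sumr_const card_ord.
  by rewrite subr_ge0 -mulr_natr -ler_pdivlMr.
by apply: ler_sum => i _; apply: tangent; rewrite x_gt0 snr.
Qed.

End ZF.

(** * Optimality of the ZF design for mean-square error and bit error rate *)

Theorem mainTheorem5 (R : realType) (P K M b : nat) (p0 : R)
    (H : 'M[R[i]]_(P, K)) (Rvv : 'M[R[i]]_P)
    (V : 'M[R[i]]_K) (lam : K.-tuple R)
    (M_gt0 : (0 < M)%N) (leMP : (M <= P)%N) (leMK : (M <= K)%N)
    (b_ge1 : (1 <= b)%N) (p0_gt0 : 0 < p0)
    (rankH : (M <= \rank H)%N) (Rvv_posdef : posdefmx Rvv)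
    (lam_evd : evd (ZF_gram H Rvv) V lam) :
  (exists F B W, @ZF_design R P K M leMK p0 H Rvv V lam F B W) /\
  forall F B W, @ZF_design R P K M leMK p0 H Rvv V lam F B W ->
  let Ree := err_cov Rvv W in
  [/\ ZF_BDFD p0 H F B W,
      Ree = (M%:R / p0 * (\prod_(i < M) lam`_i) `^ (- M%:R^-1))%:C%:M,
      forall F' B' W', @ZF_BDFD R P K M p0 H F' B' W' ->
        amse Ree <= amse (err_cov Rvv W') &
      forall F' B' W', @ZF_BDFD R P K M p0 H F' B' W' ->
        mod_high_SNR b (err_cov Rvv W') ->
        mod_high_SNR b Ree /\ ber b Ree <= ber b (err_cov Rvv W')].
Proof.
split; first exact: ZF_design_exists.
move=> F B W zf Ree.
have [zf_ok ReeE] : ZF_BDFD p0 H F B W /\ Ree = _ :=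
  ZF_design_correct M_gt0 p0_gt0 rankH Rvv_posdef lam_evd zf.
split; [exact: zf_ok | exact: ReeE | |].
- move=> F' B' W' zf'.
  have [_ le_var] :=
    ZF_BDFD_mse_bound M_gt0 leMP leMK p0_gt0 rankH Rvv_posdef lam_evd zf'.
  rewrite (amseE Rvv_posdef W'); apply: le_trans le_var.
  rewrite /amse ReeE mxtrace_scalar -rmorphMn /= -mulr_natr mulfK //.
  by rewrite pnatr_eq0 -lt0n.
- move=> F' B' W' zf'.
  exact: (ZF_ber_le M_gt0 leMP leMK p0_gt0 rankH Rvv_posdef lam_evd b_ge1 ReeE zf').
Qed.
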